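(* Let $u\in X_p$ and $z\in X_d$ solve the primal weak problem and the adjoint weak problem, respectively, let $\gamma:=\mathcal J_p(u)$, let $\gamma_p$ be the scalar component of the solution $(\gamma_p,u)$ of the primal measurement problem and $\gamma_d$ the scalar component of the solution $(\gamma_d,z)$ of the dual measurement problem. Then $$\gamma=\gamma_p=\mathcal J_p(u)=\mathcal J_d(z)=\gamma_d,$$ and their common value is $$\gamma=m(u)+\ell(z)-a(u,z).$$
   Context: Domain and coefficients: $\Omega\subset\mathbb R^d$, $d\ge2$, is a bounded Lipschitz domain with outward unit normal $n$ and $\partial\Omega=\overline{\Gamma_D}\cup\overline{\Gamma_N}$, where $\Gamma_D,\Gamma_N$ are disjoint relatively open subsets of $\partial\Omega$ and $|\Gamma_D|>0$. $A\in L^\infty(\Omega;\mathbb R^{d\times d})$ is symmetric with $a_0|\xi|^2\le\xi^TA(x)\xi\le a_1|\xi|^2$ for all $\xi\in\mathbb R^d$ and a.e. $x$, where $0<a_0\le a_1<\infty$; $b\in L^\infty(\Omega)^d$, $c\in L^\infty(\Omega)$. Data: $f_1,g_1\in L^2(\Omega)$, $f_2,g_2\in L^2(\Omega)^d$, $\psi_p,\psi_d\in L^2(\Gamma_N)$, $\phi_p,\phi_d\in H^{1/2}(\Gamma_D)$ (restrictions to $\Gamma_D$ of $H^{1/2}(\partial\Omega)$ functions). Notation: $(\cdot,\cdot)$ is the $L^2(\Omega)$ inner product, $\|\cdot\|_1$ the $H^1(\Omega)$ norm, $\langle\cdot,\cdot\rangle_{\Gamma_N}$ the $L^2(\Gamma_N)$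 pairing of traces. $H_D^1(\Omega)=\{v\in H^1(\Omega):v=0\text{ on }\Gamma_D\}$, $X_p=\{w\in H^1(\Omega):w=\phi_p\text{ on }\Gamma_D\}$, $X_d=\{v\in H^1(\Omega):v=\phi_d\text{ on }\Gamma_D\}$. For $t,s,w\in H^1(\Omega)$, $a(t,s)=(A\nabla t,\nabla s)+(b\cdot\nabla t+ct,s)$, $\ell(s)=(f_1,s)-(f_2,\nabla s)-\langle\psi_p,s\rangle_{\Gamma_N}$, $m(w)=(g_1,w)-(g_2,\nabla w)-\langle\psi_d,w\rangle_{\Gamma_N}$. Standing assumption (inf-sup): there is $\beta>0$ with $\beta=\inf_{0\ne w_0\in H_D^1(\Omega)}\sup_{0\ne v_0\in H_D^1(\Omega)}\frac{a(w_0,v_0)}{\|w_0\|_1\|v_0\|_1}=\inf_{0\ne v_0\in H_D^1(\Omega)}\sup_{0\ne w_0\in H_D^1(\Omega)}\frac{a(w_0,v_0)}{\|w_0\|_1\|v_0\|_1}$. Primal weak problem: $u\in X_p$, $a(u,s_0)=\ell(s_0)$ for all $s_0\in H_D^1(\Omega)$. Adjoint weak problem: $z\in X_d$, $a(s_0,z)=m(s_0)$ for all $s_0\in H_D^1(\Omega)$. Primal measurement problem: find $(\gamma_p,u)\in\mathbb R\times X_p$ with $\gamma_p=m(u)+\ell(v)-a(u,v)$ for all $v\in X_d$. Dual measurement problem: find $(\gamma_d,z)\in\mathbb R\times X_d$ with $\gamma_d=m(w)+\ell(z)-a(w,z)$ for all $w\in X_p$. (Both measurement problems are uniquely solvable,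 and their function components are the solutions of the corresponding weak problems.) Physical functionals, with $\sigma=-A\nabla u-f_2\in H(\mathrm{div};\Omega)$ and $r=-(A\nabla z+bz+g_2)\in H(\mathrm{div};\Omega)$ (so $\nabla\cdot\sigma=f_1-b\cdot\nabla u-cu$, $\nabla\cdot r=g_1-cz$): $\mathcal J_p(u)=(g_1,u)-(g_2,\nabla u)-\langle\psi_d,u\rangle_{\Gamma_N}-\langle(A\nabla u+f_2)\cdot n,\phi_d\rangle_{\Gamma_D}$ and $\mathcal J_d(z)=(f_1,z)-(f_2,\nabla z)-\langle\psi_p,z\rangle_{\Gamma_N}-\langle(A\nabla z+bz+g_2)\cdot n,\phi_p\rangle_{\Gamma_D}$. The Dirichlet-boundary flux terms are $\langle\sigma\cdot n,\phi_d\rangle_{\Gamma_D}$ and $\langle r\cdot n,\phi_p\rangle_{\Gamma_D}$ respectively, understood by duality: $\langle\sigma\cdot n,\phi_d\rangle_{\Gamma_D}:=(\sigma,\nabla z_d)+(\nabla\cdot\sigma,z_d)-\langle\psi_p,z_d\rangle_{\Gamma_N}$ for any $z_d\in X_d$, and $\langle r\cdot n,\phi_p\rangle_{\Gamma_D}:=(r,\nabla u_p)+(\nabla\cdot r,u_p)-\langle\psi_d,u_p\rangle_{\Gamma_N}$ for any $u_p\in X_p$ (independent of the liftings by the weak equations). *)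

(* Defs.v *)
From HB Require Import structures.
From mathcomp Require Import all_boot all_order all_algebra.
From mathcomp Require Import all_classical all_reals all_analysis.

Set Implicit Arguments.
Unset Strict Implicit.
Unset Printing Implicit Defensive.
Import Order.TTheory GRing.Theory Num.Theory.
Import numFieldNormedType.Exports.

Local Open Scope classical_set_scope.
Local Open Scope ring_scope.

(* The library norm on 'rV[R]_d is the sup norm (same topology, same bounded
   sets and Lipschitz maps); lengths use the Euclidean norm below. *)
Definition dotv (R : realType) (d : nat) (x y : 'rV[R]_d) : R :=
  \sum_(i < d) x 0 i * y 0 i.

Definition enorm (R : realType) (d : nat) (x : 'rV[R]_d) : R :=
  Num.sqrt (dotv x x).

(* [mu_ext] is stated over a semiring of sets; on [allsets T] every set is
   measurable, so that [mu_ext w] is the infimum of \sum_k w (F k) over all the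
   countable covers F, for an arbitrary weight w (possibly +oo). *)
Definition allsets (T : Type) : Type := T.

Section allsets.
Variable T : pointedType.
HB.instance Definition _ := Pointed.on (allsets T).
HB.instance Definition _ := @isMeasurable.Build default_measure_display
  (allsets T) [set: set (allsets T)] I (fun _ _ => I) (fun _ _ => I).
End allsets.

Definition caratheodory_measure (R : realType) (T : pointedType)
    (mu : {outer_measure set T -> \bar R}) :
    {measure set (caratheodory_type mu) -> \bar R} :=
  (mu : set (caratheodory_type mu) -> \bar R).

Section lebesgue.
Context (R : realType) (d : nat).
Local Open Scope ereal_scope.

Definition box (a b : 'rV[R]_d) : set 'rV[R]_d :=
  [set x | forall i, (a 0 i <= x 0 i < b 0 i)%R].

(* volume of E if E is a half-open box, and +oo otherwise *)
Definition box_weight (E : set 'rV[R]_d) : \bar R :=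
  if E == set0 then 0 else
  ereal_inf [set (\prod_(i < d) (ab.2 0 i - ab.1 0 i))%:E
            | ab in [set ab : 'rV[R]_d * 'rV[R]_d | E = box ab.1 ab.2]].

Definition lebesgue_outer (A : set 'rV[R]_d) : \bar R :=
  @mu_ext _ (allsets 'rV[R]_d) R box_weight A.

Lemma box_weight0 : box_weight set0 = 0.
Proof. by rewrite /box_weight eqxx. Qed.

Lemma box_weight_ge0 E : 0 <= box_weight E.
Proof.
rewrite /box_weight; case: ifPn => // /set0P[x Ex].
apply: le_ereal_inf_tmp => _ [[a b] /= Eab <-]; rewrite lee_fin.
apply: prodr_ge0 => i _; rewrite subr_ge0.
by move: Ex; rewrite Eab => /(_ i) /andP[+ /ltW]; exact: le_trans.
Qed.

Lemma lebesgue_outer0 : lebesgue_outer set0 = 0.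
Proof. by apply: mu_ext0; [exact: box_weight0|exact: box_weight_ge0]. Qed.

Lemma lebesgue_outer_ge0 A : 0 <= lebesgue_outer A.
Proof. by apply: mu_ext_ge0; exact: box_weight_ge0. Qed.

Lemma le_lebesgue_outer : {homo lebesgue_outer : A B / A `<=` B >-> A <= B}.
Proof. exact: (@le_mu_ext _ (allsets 'rV[R]_d)). Qed.

Lemma lebesgue_outer_sigma_subadditive : sigma_subadditive lebesgue_outer.
Proof.
by apply: (@mu_ext_sigma_subadditive _ (allsets 'rV[R]_d)); exact: box_weight_ge0.
Qed.

HB.instance Definition _ := isOuterMeasure.Build R 'rV[R]_d lebesgue_outer
  lebesgue_outer0 lebesgue_outer_ge0 le_lebesgue_outer
  lebesgue_outer_sigma_subadditive.

End lebesgue.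

(* Lebesgue measure on R^d, on the Lebesgue (= Caratheodory) sigma-algebra *)
Definition leb (R : realType) (d : nat) :=
  caratheodory_measure (@lebesgue_outer R d).

Section hausdorff.
Context (R : realType) (d s : nat).
Local Open Scope ereal_scope.

Definition diam (E : set 'rV[R]_d) : R :=
  sup [set r : R | exists x y, [/\ E x, E y & r = enorm (x - y)]].

Definition unit_ball_volume : R :=
  fine (lebesgue_outer [set x : 'rV[R]_s | (enorm x <= 1)%R]).

Definition hausdorff_weight (delta : R) (E : set 'rV[R]_d) : \bar R :=
  if E == set0 then 0 else
  if `[< forall x y, E x -> E y -> (enorm (x - y) <= delta)%R >]
  then (unit_ball_volume * (diam E / 2) ^+ s)%:E else +oo.

Definition hausdorff_outer (A : set 'rV[R]_d) : \bar R :=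
  ereal_sup [set @mu_ext _ (allsets 'rV[R]_d) R (hausdorff_weight delta) A
            | delta in [set delta : R | (0 < delta)%R]].

Lemma diam_ge0 E : (0 <= diam E)%R.
Proof.
rewrite /diam; set S := [set _ | _].
have [supS|/sup_out -> //] := pselect (has_sup S).
have [[s0 Ss0] ubS] := supS; apply: (le_trans _ (ub_le_sup ubS Ss0)).
by case: Ss0 => x [y [_ _ ->]]; exact: sqrtr_ge0.
Qed.

Lemma hausdorff_weight0 delta : hausdorff_weight delta set0 = 0.
Proof. by rewrite /hausdorff_weight eqxx. Qed.

Lemma hausdorff_weight_ge0 delta E : 0 <= hausdorff_weight delta E.
Proof.
rewrite /hausdorff_weight; case: ifPn => // _; case: ifPn => // _.
rewrite lee_fin mulr_ge0//; first exact/fine_ge0/outer_measure_ge0.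
by rewrite exprn_ge0// divr_ge0// diam_ge0.
Qed.

Lemma hausdorff_outer0 : hausdorff_outer set0 = 0.
Proof.
rewrite /hausdorff_outer (_ : [set _ | _ in _] = [set 0]) ?ereal_sup1//.
apply/seteqP; split => [_ [e _ <-]|_ ->].
  by apply: mu_ext0; [exact: hausdorff_weight0|exact: hausdorff_weight_ge0].
exists 1%R => //=.
by apply: mu_ext0; [exact: hausdorff_weight0|exact: hausdorff_weight_ge0].
Qed.

Lemma hausdorff_outer_ge0 A : 0 <= hausdorff_outer A.
Proof.
apply: le_ereal_sup_tmp; exists (@mu_ext _ (allsets 'rV[R]_d) R
  (hausdorff_weight 1) A); first by exists 1%R => /=.
by apply: mu_ext_ge0; exact: hausdorff_weight_ge0.
Qed.

Lemma le_hausdorff_outer : {homo hausdorff_outer : A B / A `<=` B >-> A <= B}.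
Proof.
move=> A B AB; apply: ge_ereal_sup => _ [e e0 <-].
apply: (@le_trans _ _ (@mu_ext _ (allsets 'rV[R]_d) R (hausdorff_weight e) B)).
  exact: (@le_mu_ext _ (allsets 'rV[R]_d)).
by apply: ereal_sup_ubound; exists e.
Qed.

Lemma hausdorff_outer_sigma_subadditive : sigma_subadditive hausdorff_outer.
Proof.
move=> F; apply: ge_ereal_sup => _ [e e0 <-].
apply: (le_trans (@mu_ext_sigma_subadditive _ (allsets 'rV[R]_d) R _
  (hausdorff_weight_ge0 e) F)).
apply: lee_nneseries => [k _ _|k _].
  by apply: mu_ext_ge0; exact: hausdorff_weight_ge0.
by apply: ereal_sup_ubound; exists e.
Qed.

HB.instance Definition _ := isOuterMeasure.Build R 'rV[R]_d hausdorff_outer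
  hausdorff_outer0 hausdorff_outer_ge0 le_hausdorff_outer
  hausdorff_outer_sigma_subadditive.

End hausdorff.
Arguments hausdorff_outer R d s A : clear implicits.

(* s-dimensional Hausdorff measure of R^d, normalized to agree with Lebesgue
   measure when s = d *)
Definition hausdorff (R : realType) (d s : nat) :=
  caratheodory_measure (hausdorff_outer R d s).

Definition surf (R : realType) (d : nat) := hausdorff R d d.-1.

Section function_spaces.
Context (dsp : measure_display) (T : measurableType dsp) (R : realType).
Variables (mu : {measure set T -> \bar R}) (D : set T).

(* L^p(D), through the extension by 0 outside D *)
Definition Lp (p : \bar R) (f : T -> R) : Prop := f \_ D \in Lfun mu p.

Definition L2_cvg (F : nat -> T -> R) (f : T -> R) : Prop :=
  (forall k, Lp 2%:E (F k \- f)) /\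
  Lnorm mu 2%:E (EFin \o ((F k \- f) \_ D)) @[k --> \oo] --> 0%E.

End function_spaces.

Section sobolev.
Context (R : realType) (d : nat).
Local Notation Rd := 'rV[R]_d.

Definition partial (i : 'I_d) (phi : Rd -> R) (x : Rd) : R :=
  'D_(delta_mx 0 i) phi x.

Fixpoint Ck (k : nat) (phi : Rd -> R) : Prop :=
  continuous phi /\
  if k is k'.+1 then
    forall i : 'I_d,
      (forall x, derivable phi x (delta_mx 0 i)) /\ Ck k' (partial i phi)
  else True.

Definition Cinfty (phi : Rd -> R) : Prop := forall k, Ck k phi.

Definition test_function (Omega : set Rd) (phi : Rd -> R) : Prop :=
  [/\ Cinfty phi, compact (closure [set x | phi x != 0])
    & closure [set x | phi x != 0] `<=` Omega].

Definition bd (Omega : set Rd) : set Rd := closure Omega `\` Omega°.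

Definition L2v (Omega : set Rd) (F : Rd -> Rd) : Prop :=
  forall i, Lp (leb R d) Omega 2%:E (fun x => F x 0 i).

Definition ip (Omega : set Rd) (f g : Rd -> R) : R :=
  \int[leb R d]_(x in Omega) (f x * g x).

Definition ipv (Omega : set Rd) (F G : Rd -> Rd) : R :=
  \int[leb R d]_(x in Omega) dotv (F x) (G x).

Definition bip (Gamma : set Rd) (f g : Rd -> R) : R :=
  \int[surf R d]_(x in Gamma) (f x * g x).

Definition grad_of (phi : Rd -> R) (x : Rd) : Rd := \row_i partial i phi x.

Definition weak_gradient (Omega : set Rd) (v : Rd -> R) (G : Rd -> Rd) : Prop :=
  forall (i : 'I_d) phi, test_function Omega phi ->
    ip Omega v (partial i phi) = - ip Omega (fun x => G x 0 i) phi.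

Definition weak_divergence (Omega : set Rd) (F : Rd -> Rd) (q : Rd -> R) : Prop :=
  forall phi, test_function Omega phi ->
    ipv Omega F (grad_of phi) = - ip Omega q phi.

(* The trace operator H^1(Omega) -> L^2(bd Omega) is the continuous extension
   of phi |-> phi|_(bd Omega), phi smooth up to the boundary; its graph is the
   closure of the graph of that restriction map. *)
Definition has_trace (Omega : set Rd) (v : Rd -> R) (G : Rd -> Rd)
    (tau : Rd -> R) : Prop :=
  exists phi : nat -> Rd -> R,
    [/\ forall k, Cinfty (phi k),
        L2_cvg (leb R d) Omega phi v,
        forall i, L2_cvg (leb R d) Omega (fun k => partial i (phi k))
                         (fun x => G x 0 i)
      & L2_cvg (surf R d) (bd Omega) phi tau].

(* An element of H^1(Omega), with representatives of its weak gradient and of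
   its trace (on a Lipschitz domain both are determined a.e. by the function). *)
Record H1 (Omega : set Rd) := MkH1 {
  H1fun :> Rd -> R ;
  grad : Rd -> Rd ;
  trace : Rd -> R ;
  H1_L2 : Lp (leb R d) Omega 2%:E H1fun ;
  grad_L2 : L2v Omega grad ;
  grad_weak : weak_gradient Omega H1fun grad ;
  trace_L2 : Lp (surf R d) (bd Omega) 2%:E trace ;
  traceP : has_trace Omega H1fun grad trace
}.

Definition H1norm (Omega : set Rd) (v : H1 Omega) : R :=
  Num.sqrt (ip Omega v v + ipv Omega (grad v) (grad v)).

Definition trace_eq (Omega Gamma : set Rd) (phi : Rd -> R) (v : H1 Omega) : Prop :=
  {ae surf R d, forall x, Gamma x -> trace v x = phi x}.

(* H^(1/2)(bd Omega) is the range of the trace operator on H^1(Omega). *)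
Definition Hhalf (Omega Gamma : set Rd) (phi : Rd -> R) : Prop :=
  exists w : H1 Omega, trace_eq Gamma phi w.

Definition lipschitz_boundary (Omega : set Rd) : Prop :=
  forall x0, bd Omega x0 ->
    exists (Q : 'M[R]_d) (i : 'I_d) (g : 'rV[R]_(d.-1) -> R),
      [/\ Q *m Q^T = 1%:M, exists k : R, k.-lipschitz g
        & \forall x \near x0,
            Omega x <-> g (col' i (x *m Q)) < (x *m Q) 0 i].

Definition bounded_lipschitz_domain (Omega : set Rd) : Prop :=
  [/\ open Omega, connected Omega, Omega !=set0, bounded_set Omega
    & lipschitz_boundary Omega].

Definition rel_open (S Gamma : set Rd) : Prop :=
  exists2 U, open U & Gamma = U `&` S.

Definition boundary_partition (Omega GammaD GammaN : set Rd) : Prop :=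
  [/\ rel_open (bd Omega) GammaD, rel_open (bd Omega) GammaN,
      GammaD `&` GammaN = set0
    & bd Omega = closure GammaD `|` closure GammaN].

End sobolev.

Record problem (R : realType) (d : nat) := MkProblem {
  Omega : set 'rV[R]_d ;
  GammaD : set 'rV[R]_d ;
  GammaN : set 'rV[R]_d ;
  coefA : 'rV[R]_d -> 'M[R]_d ;
  coefb : 'rV[R]_d -> 'rV[R]_d ;
  coefc : 'rV[R]_d -> R ;
  dat_f1 : 'rV[R]_d -> R ;
  dat_g1 : 'rV[R]_d -> R ;
  dat_f2 : 'rV[R]_d -> 'rV[R]_d ;
  dat_g2 : 'rV[R]_d -> 'rV[R]_d ;
  psip : 'rV[R]_d -> R ;
  psid : 'rV[R]_d -> R ;
  phip : 'rV[R]_d -> R ;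
  phid : 'rV[R]_d -> R
}.

Section weak_problem.
Context (R : realType) (d : nat).
Variable P : problem R d.
Local Notation Rd := 'rV[R]_d.
Local Notation Om := (Omega P).
Local Notation H := (H1 (Omega P)).

(* A(x) applied to a vector field stored as a row *)
Definition Amul (F : Rd -> Rd) (x : Rd) : Rd := F x *m (coefA P x)^T.

Definition coefficients_ok (a0 a1 : R) : Prop :=
  [/\ forall i j, Lp (leb R d) Om +oo (fun x => coefA P x i j),
      {ae leb R d, forall x, Om x -> (coefA P x)^T = coefA P x /\
        forall xi : Rd, a0 * enorm xi ^+ 2 <= dotv (xi *m coefA P x) xi
                     /\ dotv (xi *m coefA P x) xi <= a1 * enorm xi ^+ 2},
      forall i, Lp (leb R d) Om +oo (fun x => coefb P x 0 i)
    & Lp (leb R d) Om +oo (coefc P)].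

Definition data_ok : Prop :=
  [/\ Lp (leb R d) Om 2%:E (dat_f1 P) /\ Lp (leb R d) Om 2%:E (dat_g1 P),
      L2v Om (dat_f2 P) /\ L2v Om (dat_g2 P),
      Lp (surf R d) (GammaN P) 2%:E (psip P)
        /\ Lp (surf R d) (GammaN P) 2%:E (psid P)
    & Hhalf Om (GammaD P) (phip P) /\ Hhalf Om (GammaD P) (phid P)].

Definition HD (v : H) : Prop := trace_eq (GammaD P) (fun=> 0) v.
Definition Xp (v : H) : Prop := trace_eq (GammaD P) (phip P) v.
Definition Xd (v : H) : Prop := trace_eq (GammaD P) (phid P) v.

Definition aform (t s : H) : R :=
  ipv Om (Amul (grad t)) (grad s)
  + ip Om (fun x => dotv (coefb P x) (grad t x) + coefc P x * t x) s.

Definition ellfunctional (s : H) : R :=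
  ip Om (dat_f1 P) s - ipv Om (dat_f2 P) (grad s) - bip (GammaN P) (psip P) (trace s).

Definition mfunctional (w : H) : R :=
  ip Om (dat_g1 P) w - ipv Om (dat_g2 P) (grad w) - bip (GammaN P) (psid P) (trace w).

(* infima and suprema are taken in the extended reals *)
Definition inf_sup (beta : R) : Prop :=
  beta%:E = ereal_inf [set ereal_sup
     [set (aform w v / (H1norm w * H1norm v))%:E | v in [set v | HD v /\ H1norm v != 0]]
     | w in [set w | HD w /\ H1norm w != 0]]
  /\
  beta%:E = ereal_inf [set ereal_sup
     [set (aform w v / (H1norm w * H1norm v))%:E | w in [set w | HD w /\ H1norm w != 0]]
     | v in [set v | HD v /\ H1norm v != 0]].

Definition primal_weak (u : H) : Prop :=
  Xp u /\ forall s0, HD s0 -> aform u s0 = ellfunctional s0.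

Definition adjoint_weak (z : H) : Prop :=
  Xd z /\ forall s0, HD s0 -> aform s0 z = mfunctional s0.

Definition primal_measurement (gamma : R) (u : H) : Prop :=
  Xp u /\ forall v, Xd v -> gamma = mfunctional u + ellfunctional v - aform u v.

Definition dual_measurement (gamma : R) (z : H) : Prop :=
  Xd z /\ forall w, Xp w -> gamma = mfunctional w + ellfunctional z - aform w z.

(* <F.n, phi>_GammaD for F in H(div) with Neumann data psi on GammaN: the value
   (F, grad l) + (div F, l) - <psi, l>_GammaN, for any lifting l of phi. *)
Definition flux_pairing (F : Rd -> Rd) (psi phi : Rd -> R) : R :=
  get [set y : R | exists (q : Rd -> R) (l : H),
    [/\ Lp (leb R d) Om 2%:E q, weak_divergence Om F q,
        trace_eq (GammaD P) phi l
      & y = ipv Om F (grad l) + ip Om q l - bip (GammaN P) psi (trace l)]].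

Definition flux_p (u : H) (x : Rd) : Rd := - Amul (grad u) x - dat_f2 P x.

Definition flux_d (z : H) (x : Rd) : Rd :=
  - (Amul (grad z) x + z x *: coefb P x + dat_g2 P x).

Definition Jp (u : H) : R :=
  ip Om (dat_g1 P) u - ipv Om (dat_g2 P) (grad u) - bip (GammaN P) (psid P) (trace u)
  + flux_pairing (flux_p u) (psip P) (phid P).

Definition Jd (z : H) : R :=
  ip Om (dat_f1 P) z - ipv Om (dat_f2 P) (grad z) - bip (GammaN P) (psip P) (trace z)
  + flux_pairing (flux_d z) (psid P) (phip P).

End weak_problem.

(* Main.v *)
Require Import Defs.
From HB Require Import structures.
From mathcomp Require Import all_boot all_order all_algebra.
From mathcomp Require Import all_classical all_reals all_analysis.
From mathcomp Require Import measurable_realfun ess_sup_inf.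
From mathcomp Require Import ring lra.
Import Order.TTheory GRing.Theory Num.Theory.
Import numFieldNormedType.Exports.
Local Open Scope classical_set_scope.
Local Open Scope ring_scope.

(** The two measurement equations at v = z and w = u give
    gamma_p = m(u) + ell(z) - a(u,z) = gamma_d, so it remains to evaluate the
    two Dirichlet flux terms.  Testing the weak equations against smooth
    functions compactly supported in Omega shows that sigma and r have the
    expected weak divergences, and unfolding a, ell and m then turns the flux
    pairing along any lifting l into ell(l) - a(u,l), resp. m(l) - a(l,z),
    which the measurement equations make independent of l.  The pairing does
    not depend on the chosen divergence either: if q in L^2 annihilates all
    test functions then (q, l) = 0 for every l in H^1, because l is an L^2
    limit of smooth functions phi_k and (q, phi_k) is the limit of
    (q, phi_k chi_m) for smooth cutoffs 0 <= chi_m <= 1 tending to 1 on Omega. *)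

Set Implicit Arguments.
Unset Strict Implicit.
Unset Printing Implicit Defensive.

Lemma le1_2e (R : realType) : (1 <= 2%:E :> \bar R)%E.
Proof. by rewrite lee_fin ler1n. Qed.

(** * L^p spaces on a measurable subset *)

Section Lp_theory.
Context (dsp : measure_display) (T : measurableType dsp) (R : realType).
Variables (mu : {measure set T -> \bar R}) (D : set T).
Hypothesis mD : measurable D.

Lemma measurable_Lp p (f : T -> R) : Lp mu D p f -> measurable_fun D f.
Proof.
by rewrite /Lp inE => /andP[/[!inE]/= mf _]; exact/(measurable_restrictT f mD).
Qed.

(** [Lp] speaks of the extension by zero; this brings membership in L^2 back to [D] itself, where
    integrands can be compared pointwise. *)
Lemma Lp2P (f : T -> R) : Lp mu D 2%:E f <->
  measurable_fun D f /\ mu.-integrable D (fun x => (f x ^+ 2)%:E).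
Proof.
have restrict_sqr : EFin \o (fun x => (f \_ D) x ^+ 2) =
    (fun x => (f x ^+ 2)%:E) \_ D.
  by apply/funext => x; rewrite /= !patchE; case: ifP => //; rewrite expr0n.
split=> [fL|[mf]].
  split; first exact: measurable_Lp fL.
  by apply/(integrable_mkcond _ mD); rewrite -restrict_sqr; exact: Lfun2_integrable_sqr.
move=> /(integrable_mkcond _ mD); rewrite -restrict_sqr => /integrableP[_ ifoo].
rewrite /Lp inE; apply/andP; split; rewrite inE/=.
  exact/(measurable_restrictT f mD).
rewrite /finite_norm unlock poweR_lty//.
rewrite (le_lt_trans _ ifoo)// le_eqVlt; apply/orP; left; apply/eqP.
by apply: eq_integral => x _ /=; rewrite powR_mulrn// normrX.
Qed.

Lemma integrable_Lp2M (f g : T -> R) : Lp mu D 2%:E f -> Lp mu D 2%:E g ->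
  mu.-integrable D (EFin \o (f \* g)).
Proof.
move=> fL gL; apply/(integrable_mkcond _ mD).
have /Lfun1_integrable := Lfun2_mul_Lfun1 fL gL.
congr (integrable _ _ _); apply/funext => x /=; rewrite !patchE.
by case: ifP => //; rewrite mul0r.
Qed.

Lemma LpD p (f g : T -> R) : (1 <= p)%E -> Lp mu D p f -> Lp mu D p g ->
  Lp mu D p (f \+ g).
Proof.
rewrite /Lp => p1 fL gL; rewrite (_ : _ \_ D = (f \_ D) \+ (g \_ D)).
  by have := Lfun_addr_closed mu p1 => -[_]; exact.
by apply/funext => x /=; rewrite !patchE; case: ifP; rewrite ?addr0.
Qed.

Lemma LpN p (f : T -> R) : Lp mu D p f -> Lp mu D p (\- f).
Proof.
rewrite /Lp => fL; rewrite (_ : _ \_ D = \- (f \_ D)).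
  exact: Lfun_oppr_closed.
by apply/funext => x /=; rewrite !patchE; case: ifP; rewrite ?oppr0.
Qed.

Lemma LpB p (f g : T -> R) : (1 <= p)%E -> Lp mu D p f -> Lp mu D p g ->
  Lp mu D p (f \- g).
Proof. by move=> p1 fL gL; apply: (LpD p1 fL); exact: LpN. Qed.

Lemma Lp0 p : (1 <= p)%E -> Lp mu D p (fun=> 0).
Proof.
move=> p1; rewrite /Lp (_ : _ \_ D = cst 0).
  by have := Lfun_addr_closed mu p1 => -[].
by apply/funext => x; rewrite patchE; case: ifP.
Qed.

Lemma Lp_sum p (I : finType) (f : I -> T -> R) : (1 <= p)%E ->
  (forall i, Lp mu D p (f i)) -> Lp mu D p (fun x => \sum_i f i x).
Proof.
move=> p1 fL; suff: forall s : seq I, Lp mu D p (fun x => \sum_(i <- s) f i x) by exact.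
elim=> [|i s ih].
  by under eq_fun do rewrite big_nil; exact: Lp0.
by under eq_fun do rewrite big_cons; exact: LpD.
Qed.

Lemma Lpoo_bounded (f : T -> R) : Lp mu D +oo f ->
  exists M, {ae mu, forall x, D x -> `|f x| <= M}.
Proof.
rewrite /Lp inE => /andP[/[!inE]/= mf]; rewrite /finite_norm unlock /Lnorm.
case: ifPn => [mu_gt0 supf|].
  have [M fM] := @ess_supr_bounded _ _ _ mu (Num.norm \o (f \_ D)) supf.
  by exists M; apply: filterS fM => x /= + Dx; rewrite patchE mem_set.
(* When the whole space is null, the norm is 0 by convention and carries no information on [f]; but
   then any bound holds almost everywhere. *)
rewrite -leNgt => muT0 _; exists 0; exists setT; split => //.
by apply/eqP; rewrite eq_le muT0 measure_ge0.
Qed.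

Lemma LpooM2 (b f : T -> R) : Lp mu D +oo b -> Lp mu D 2%:E f ->
  Lp mu D 2%:E (b \* f).
Proof.
move=> bL fL; have [M bM] := Lpoo_bounded bL.
have mb := measurable_Lp bL.
have [mf /integrableP[mf2 if2]] := (Lp2P _).1 fL.
have mbf : measurable_fun D (b \* f) by exact: measurable_funM.
have mbf2 : measurable_fun D (EFin \o (fun x => (b \* f) x ^+ 2)).
  by apply/measurable_EFinP; exact: measurable_funX.
apply/Lp2P; split => //; apply/integrableP; split => //.
apply: (@le_lt_trans _ _ (\int[mu]_(x in D) ((M ^+ 2)%:E * `|(f x ^+ 2)%:E|))%E).
  apply: ae_ge0_le_integral => //.
  - exact: measurableT_comp.
  - by move=> x _; rewrite mule_ge0// lee_fin sqr_ge0.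
  - by apply: measurable_funeM; exact: measurableT_comp.
  apply: filterS bM => x /= bM Dx; move/(_ Dx) : bM => bM.
  rewrite -EFinM lee_fin exprMn normrM ler_wpM2r// normrX.
  by rewrite lerXn2r ?nnegrE// (le_trans _ bM).
have M2_ge0 : (0 <= (M ^+ 2)%:E)%E by rewrite lee_fin sqr_ge0.
by rewrite ge0_integralZl// ?lte_mul_pinfty//; exact: measurableT_comp.
Qed.

(** Cauchy-Schwarz: Hoelder's inequality with both exponents equal to 2, applied to the extensions
    by zero. *)
Lemma hoelder_Lp2 (f g : T -> R) : Lp mu D 2%:E f -> Lp mu D 2%:E g ->
  (`|\int[mu]_(x in D) (f x * g x)|%:E <=
    Lnorm mu 2%:E (EFin \o (f \_ D)) * Lnorm mu 2%:E (EFin \o (g \_ D)))%E.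
Proof.
move=> fL gL; rewrite EFin_normr_Rintegral//; last exact: integrable_Lp2M.
apply: (@le_trans _ _ (Lnorm mu 1 (EFin \o ((f \_ D) \* (g \_ D))))); last first.
  move: fL gL; rewrite /Lp !inE => /andP[/[!inE]/= mf _] /andP[/[!inE]/= mg _].
  by apply: hoelder => //; rewrite [RHS]splitr !div1r.
rewrite Lnorm1 integral_mkcond; apply: le_trans (le_abse_integral _ _ _) _ => //.
  apply/(measurable_restrictT _ mD); apply/measurable_EFinP.
  by apply: measurable_funM; [exact: measurable_Lp fL|exact: measurable_Lp gL].
rewrite le_eqVlt; apply/orP; left; apply/eqP; apply: eq_integral => x _.
by rewrite /= !patchE; case: ifP => //; rewrite mulr0.
Qed.

(** Serves identities that rest on an almost-everywhere assumption, packed in [Q], such as the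
    symmetry of the diffusion matrix. *)
Lemma ae_eq_Rintegral (f g : T -> R) (Q : T -> Prop) :
  measurable_fun D f -> measurable_fun D g ->
  {ae mu, forall x, D x -> Q x} -> (forall x, Q x -> f x = g x) ->
  \int[mu]_(x in D) f x = \int[mu]_(x in D) g x.
Proof.
move=> mf mg aeQ fg; congr fine; apply: ae_eq_integral => //;
  [exact/measurable_EFinP|exact/measurable_EFinP|].
by apply: filterS aeQ => x Qx /Qx /fg ->.
Qed.

(** Provides the constant approximating sequences by which an already smooth function satisfies
    [has_trace]. *)
Lemma L2_cvg_cst (f g : T -> R) : (forall x, D x -> f x = g x) ->
  L2_cvg mu D (fun=> f) g.
Proof.
move=> fg; have fg0 : (f \- g) \_ D = (fun=> 0) \_ D.
  apply/funext => x; rewrite !patchE; case: ifPn => // /set_mem Dx /=.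
  by rewrite fg// subrr.
split=> [_|]; first by rewrite /Lp fg0; exact: (Lp0 (le1_2e R)).
rewrite fg0 (_ : EFin \o _ = cst 0%E).
  by under eq_fun do rewrite Lnorm0//; exact: cvg_cst.
by apply/funext => x /=; rewrite patchE; case: ifP.
Qed.

End Lp_theory.

(** * Smooth functions *)

Section flat_exp.
Context (R : realType).
Implicit Types (n : nat) (t : R).

(* With the extra factor t^-n the family is closed under differentiation
   (h_n' = h_(n+2) - n h_(n+1)), so smoothness follows by induction. *)
Definition flat_exp n t : R := if 0 < t then t ^- n * expR (- t^-1) else 0.

Lemma flat_exp_ge0 n t : 0 <= flat_exp n t.
Proof.
rewrite /flat_exp; case: ifPn => // t0.
by rewrite mulr_ge0 ?expR_ge0// invr_ge0 exprn_ge0// ltW.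
Qed.

(** The exponential series at 1/t dominates its term of degree n + 2, so exp(-1/t) <= (n+2)! t^(n+2)
    for t > 0. The two spare powers of t force the derivative at 0 to vanish. *)
Lemma flat_exp_le n t : flat_exp n t <= n.+2`!%:R * t ^+ 2.
Proof.
rewrite /flat_exp; case: ifPn => [t0|_]; last by rewrite mulr_ge0// sqr_ge0.
have tV0 : 0 < t^-1 by rewrite invr_gt0.
have exp_le : t^-1 ^+ n.+2 / n.+2`!%:R <= expR t^-1.
  by apply: le_trans (expR_ge1Dxn n.+1 (ltW tV0)); rewrite lerDr.
have fact0 : 0 < n.+2`!%:R :> R by rewrite ltr0n fact_gt0.
rewrite expRN -exprVn ler_pdivrMr ?expR_gt0//.
have -> : t^-1 ^+ n = n.+2`!%:R * t ^+ 2 * (t^-1 ^+ n.+2 / n.+2`!%:R).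
  rewrite [t^-1 ^+ n.+2]exprSr [t^-1 ^+ n.+1]exprSr.
  move: (_ ^+ n) (n.+2`!%:R : R) fact0 => X F F0.
  by field; rewrite !gt_eqF.
by rewrite ler_wpM2l// mulr_ge0// ?ltW// exprn_gt0.
Qed.

Lemma is_derive_flat_exp n t :
  is_derive t 1 (flat_exp n) (flat_exp n.+2 t - n%:R * flat_exp n.+1 t).
Proof.
have [t0|t0|<-] := ltgtP 0 t.
- have nearE : \near t, t ^- n * expR (- t^-1) = flat_exp n t.
    near=> s; rewrite /flat_exp ifT//; near: s.
    exact: lt_nbhsr.
  apply: (near_eq_is_derive nearE).
  have tN0 : t != 0 by rewrite gt_eqF.
  have dV : is_derive t 1 (fun s : R => s^-1) (- t ^- 2 *: 1).
    exact: (is_deriveV (f := id)).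
  have dexp := is_derive1_comp (f := expR) (is_derive_expR _) (is_deriveN dV).
  have := is_deriveM (is_deriveX n dV) dexp.
  have -> : (GRing.inv : R -> R) ^+ n * (expR \o - (GRing.inv : R -> R)) =
      (fun s => s ^- n * expR (- s^-1)).
    by apply/funext => s; rewrite /= -exprVn exprfctE.
  move=> dM; apply: is_derive_eq dM _; rewrite /flat_exp t0 exprfctE /=.
  rewrite -[_ *: _ + _]/(_ * _ + _ * _) -[(_ * _) *: _]/(_ * _ * _).
  rewrite -!exprVn -[- _%:A]/(- (- _ * 1)) -[(- _)%:A]/(- _ * 1).
  (* The power rule involves the exponent n - 1, which truncates at n = 0; that case is treated
     apart. *)
  case: n {nearE} => [|m]; first by rewrite expr0 mulr0n; ring.
  by rewrite /= !exprS expr0; ring.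
- rewrite /flat_exp ltNge (ltW t0)/= mulr0 subrr -/(flat_exp n).
  have nearE : \near t, cst 0 t = flat_exp n t.
    near=> s; rewrite /flat_exp ifN// -leNgt ltW//; near: s.
    exact: lt_nbhsl.
  by apply: (near_eq_is_derive nearE); exact: is_derive_cst.
(* At the junction 0, [flat_exp_le] bounds the difference quotient by (n+2)! |h|. *)
- rewrite {2 3}/flat_exp ltxx mulr0 subrr.
  suff h : (fun h => h^-1 *: ((flat_exp n \o shift 0) (h *: 1) - flat_exp n 0))
      @ 0^' --> (0 : R).
    by apply: DeriveDef; [apply/cvg_ex; exists 0|exact/cvg_lim].
  apply/cvgr0Pnorm_le => e e0; near=> h.
  have h0 : h != 0 by near: h; exact: nbhs_dnbhs_neq.
  rewrite /= addr0 [h%:A]mulr1 {2}/flat_exp ltxx subr0 normrM normfV.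
  rewrite (ger0_norm (flat_exp_ge0 _ _)) ler_pdivrMl ?normr_gt0//.
  apply: le_trans (flat_exp_le _ _) _.
  rewrite -real_normK ?num_real// expr2 mulrA [leRHS]mulrC ler_wpM2r//.
  rewrite -ler_pdivlMl ?ltr0n ?fact_gt0//; near: h.
  apply: dnbhs0_le; rewrite mulr_gt0// invr_gt0 ltr0n fact_gt0.
Unshelve. all: by end_near. Qed.

Lemma continuous_flat_exp n : continuous (flat_exp n).
Proof.
move=> t; have [dt _] := is_derive_flat_exp n t.
exact/differentiable_continuous/derivable1_diffP.
Qed.

End flat_exp.

(** * Calculus of C^k functions of several variables *)

Section Ck_theory.
Context (R : realType) (d : nat).
Local Notation Rd := 'rV[R]_d.
Implicit Types (f g : Rd -> R) (k : nat) (i : 'I_d).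

Lemma CkS k f : Ck k.+1 f -> Ck k f.
Proof.
elim: k f => [f []//|k ih f [cf df]]; split=> // i.
by have [? ?] := df i; split => //; exact: ih.
Qed.

Lemma Ck_cst k (c : R) : Ck k (cst c : Rd -> R).
Proof.
elim: k c => [|k ih] c; first by split => //; exact: cst_continuous.
split=> [|i]; first exact: cst_continuous.
split=> [x|]; first exact: derivable_cst.
rewrite (_ : partial i _ = cst 0)//.
by apply/funext => x; rewrite /partial derive_cst.
Qed.

Lemma partialD i f g : (forall x, derivable f x (delta_mx 0 i)) ->
  (forall x, derivable g x (delta_mx 0 i)) ->
  partial i (f \+ g) = partial i f \+ partial i g.
Proof. by move=> df dg; apply/funext => x; exact: deriveD. Qed.

Lemma partialM i f g : (forall x, derivable f x (delta_mx 0 i)) ->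
  (forall x, derivable g x (delta_mx 0 i)) ->
  partial i (f \* g) = (f \* partial i g) \+ (g \* partial i f).
Proof. by move=> df dg; apply/funext => x; exact: deriveM. Qed.

Lemma CkD k f g : Ck k f -> Ck k g -> Ck k (f \+ g).
Proof.
elim: k f g => [|k ih] f g [cf df] [cg dg].
  by split => // x; apply: continuousD; [exact: cf|exact: cg].
split=> [x|i]; first by apply: continuousD; [exact: cf|exact: cg].
have [dfi Cf] := df i; have [dgi Cg] := dg i.
by split=> [x|]; [exact: derivableD|rewrite partialD//; exact: ih].
Qed.

Lemma CkM k f g : Ck k f -> Ck k g -> Ck k (f \* g).
Proof.
elim: k f g => [|k ih] f g /[dup] Ckf [cf df] /[dup] Ckg [cg dg].
  by split => // x; apply: continuousM; [exact: cf|exact: cg].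
split=> [x|i]; first by apply: continuousM; [exact: cf|exact: cg].
have [dfi Cf] := df i; have [dgi Cg] := dg i.
split=> [x|]; first exact: derivableM.
by rewrite partialM//; apply: CkD; apply: ih => //; exact: CkS.
Qed.

Lemma CkZ k (c : R) f : Ck k f -> Ck k (fun x => c * f x).
Proof. by move=> Cf; apply: (CkM (f := cst c)) => //; exact: Ck_cst. Qed.

Lemma Ck_prod k (I : Type) (s : seq I) (f : I -> Rd -> R) :
  (forall j, Ck k (f j)) -> Ck k (fun x => \prod_(i <- s) f i x).
Proof.
move=> Cf; elim: s => [|i s ih].
  by under eq_fun do rewrite big_nil; exact: Ck_cst.
by under eq_fun do rewrite big_cons; exact: CkM.
Qed.

(** Along the line x + t e_i the function is [h] composed with an affine function of t, so the
    one-variable chain rule suffices. *)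
Lemma is_derive_coord (h : R -> R) (a b dh : R) (i j : 'I_d) (x : Rd) :
  is_derive (a * x 0 j + b) 1 h dh ->
  is_derive x (delta_mx 0 i) (fun y => h (a * y 0 j + b)) (a * (i == j)%:R * dh).
Proof.
move=> hd; set f := fun y => _; set v := delta_mx 0 i.
pose g (t : R) := h (a * (i == j)%:R * t + (a * x 0 j + b)).
have fg : (fun t : R => f (t *: v + x)) = g.
  apply/funext => t; rewrite /f /g !mxE eqxx/= eq_sym; congr (h _); ring.
have gd : is_derive (0 : R) 1 g (a * (i == j)%:R * dh).
  pose A := a * (i == j)%:R; pose B := a * x 0 j + b.
  have dA : is_derive (0 : R) 1 (fun t => A * t + B) A.
    have := is_deriveD (is_deriveZ A (is_derive_id (0 : R) 1)) (is_derive_cst B _ _).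
    by rewrite addr0 [_%:A]mulr1.
  rewrite mulrC; apply: is_derive1_comp dA.
  by rewrite mulr0 add0r.
have quotient : (fun t => t^-1 *: ((f \o shift x) (t *: v) - f x)) =
    (fun t => t^-1 *: ((g \o shift 0) (t *: 1) - g 0)).
  apply/funext => t /=; rewrite -fg scale0r add0r addr0.
  by rewrite [t%:A]mulr1.
by case: gd => gd1 gd2; split; [rewrite /derivable quotient|rewrite /derive quotient].
Qed.

Lemma Ck_flat_exp k n (a b : R) (j : 'I_d) :
  Ck k (fun x => flat_exp n (a * x 0 j + b)).
Proof.
have cont m : continuous (fun x : Rd => flat_exp m (a * x 0 j + b)).
  move=> x; apply: (@continuous_comp _ _ _ (fun x : Rd => a * x 0 j + b)).
    apply: continuousD; last exact: cst_continuous.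
    by apply: continuousM; [exact: cst_continuous|exact: coord_continuous].
  exact: continuous_flat_exp.
elim: k n => [|k ih] n; first by split.
split => // i; split => [x|].
  by have [] := is_derive_coord i (is_derive_flat_exp n (a * x 0 j + b)).
rewrite (_ : partial i _ = fun x => a * (i == j)%:R *
   (flat_exp n.+2 (a * x 0 j + b) + - n%:R * flat_exp n.+1 (a * x 0 j + b))).
  by apply: CkZ; apply: CkD => //; exact: CkZ.
apply/funext => x; rewrite /partial mulNr.
by have [] := is_derive_coord i (is_derive_flat_exp n (a * x 0 j + b)).
Qed.

End Ck_theory.

(** * Lebesgue measure on R^d *)

Lemma le_coord_norm (R : realType) (d : nat) (x : 'rV[R]_d) i : `|x 0 i| <= `|x|.
Proof.
rewrite [leRHS]/Num.norm /= mx_normrE; apply/bigmax_geP; right => /=.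
by exists (0, i).
Qed.

Section box_weight.
Context (R : realType) (d : nat).
Local Notation Rd := 'rV[R]_d.
Local Open Scope ereal_scope.
Implicit Types (a b x y : Rd) (i : 'I_d) (E : set Rd).

Lemma box_lt a b : box a b !=set0 -> forall i, (a 0 i < b 0 i)%R.
Proof. by move=> [x abx] i; have /andP[] := abx i; exact: le_lt_trans. Qed.

Lemma box_weight_le a b : (forall i, (a 0 i <= b 0 i)%R) ->
  box_weight (box a b) <= (\prod_(i < d) (b 0 i - a 0 i))%:E.
Proof.
move=> ab; rewrite /box_weight; case: ifPn => [_|_].
  by rewrite lee_fin; apply: prodr_ge0 => i _; rewrite subr_ge0.
by apply: ereal_inf_lbound; exists (a, b).
Qed.

Lemma box_weight_translation y E :
  box_weight ((fun x => x + y)%R @^-1` E) <= box_weight E.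
Proof.
rewrite {2}/box_weight; case: ifPn => [/eqP ->|/set0P[x0 Ex0]].
  by rewrite preimage_set0 box_weight0.
apply: le_ereal_inf_tmp => _ [[a b]/= Eab <-].
have -> : (fun x => x + y)%R @^-1` E = box (a - y) (b - y).
  by rewrite Eab; apply/seteqP; split => x /= h i; move: (h i);
    rewrite !mxE lerBlDr ltrBrDr.
have ab := box_lt (ex_intro _ x0 _ : box a b !=set0).
apply: le_trans (box_weight_le _) _ => [i|].
  by rewrite !mxE lerD2r ltW// ab// -Eab.
rewrite lee_fin le_eqVlt; apply/orP; left; apply/eqP/eq_bigr => i _.
by rewrite !mxE; ring.
Qed.

Lemma lebesgue_outer_translation_le y E :
  lebesgue_outer ((fun x => x + y)%R @^-1` E) <= lebesgue_outer E.
Proof.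
apply: le_ereal_inf_tmp => _ [F [_ EF] <-].
apply: (@le_trans _ _ (\sum_(k <oo) box_weight ((fun x => x + y)%R @^-1` F k))).
  apply: ereal_inf_lbound; exists (fun k => (fun x => x + y)%R @^-1` F k) => //.
  by split => // x /EF[k _ Fkx]; exists k.
apply: lee_nneseries => k _ *; first exact: box_weight_ge0.
exact: box_weight_translation.
Qed.

Lemma lebesgue_outer_translation y E :
  lebesgue_outer ((fun x => x + y)%R @^-1` E) = lebesgue_outer E.
Proof.
apply/eqP; rewrite eq_le lebesgue_outer_translation_le/=.
(* Translating back by [- y] turns the inequality already proved into its converse. *)
rewrite -{1}[E](_ : (fun x => x + - y)%R @^-1` ((fun x => x + y)%R @^-1` E) = E).
  exact: lebesgue_outer_translation_le.
by apply/seteqP; split => x /=; rewrite subrK.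
Qed.

Lemma lebesgue_outer_box_lty a b : lebesgue_outer (box a b) < +oo.
Proof.
have [box0|/set0P/box_lt ab] := eqVneq (box a b) set0.
  by rewrite box0 lebesgue_outer0.
apply: (@le_lt_trans _ _ (box_weight (box a b))); last first.
  by rewrite (le_lt_trans (box_weight_le _)) ?ltry// => i; exact: ltW.
apply: ereal_inf_lbound; exists (fun k => if k == 0%N then box a b else set0).
  by split => // x abx; exists 0%N.
rewrite (nneseriesD1 (n := 0%N))//; last by move=> k _; exact: box_weight_ge0.
rewrite /= eseries0 ?adde0// => k _ /negPf ->.
exact: box_weight0.
Qed.

Definition halfspace i (c : R) : set Rd := [set x | (x 0 i < c)%R].

(* A half-space cuts a half-open box into two such boxes; this additivity of the
   weight is what makes half-spaces Caratheodory measurable. *)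
Lemma box_weight_halfspace i c E :
  box_weight (E `&` halfspace i c) + box_weight (E `&` ~` halfspace i c) <=
  box_weight E.
Proof.
rewrite {3}/box_weight; case: ifPn => [/eqP ->|/set0P E0].
  by rewrite !set0I box_weight0 adde0.
apply: le_ereal_inf_tmp => _ [[a b]/= Eab <-].
have ab : forall j, (a 0 j < b 0 j)%R by apply: box_lt; rewrite -Eab.
have ab' j : (a 0 j <= b 0 j)%R by exact: ltW.
have [ca|ac] := leP c (a 0 i)%R.
  have -> : E `&` halfspace i c = set0.
    apply/seteqP; split => // x [+ xc]; rewrite Eab => /(_ i)/andP[+ _].
    by move=> /(le_trans ca); rewrite leNgt xc.
  have -> : E `&` ~` halfspace i c = box a b.
    rewrite -Eab; apply/seteqP; split => [x []//|x Ex]; split => //.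
    move: Ex; rewrite Eab => /(_ i)/andP[+ _] => /(le_trans ca).
    by rewrite leNgt => /negP.
  by rewrite box_weight0 add0e; exact: box_weight_le.
have [bc|cb] := leP (b 0 i)%R c.
  have -> : E `&` ~` halfspace i c = set0.
    apply/seteqP; split => // x [+ xc]; rewrite Eab => /(_ i)/andP[_ +].
    by move=> /lt_le_trans/(_ bc).
  have -> : E `&` halfspace i c = box a b.
    rewrite -Eab; apply/seteqP; split => [x []//|x Ex]; split => //.
    by move: Ex; rewrite Eab => /(_ i)/andP[_] /lt_le_trans/(_ bc).
  by rewrite box_weight0 adde0; exact: box_weight_le.
(* Here c lies strictly between the endpoints of side i. Replacing one of them by c gives the two
   pieces, whose volumes differ from that of the whole only in the factor of index i, where (c -
   a_i) + (b_i - c) = b_i - a_i. *)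
pose b' : Rd := (\row_j if j == i then c else b 0 j)%R.
pose a' : Rd := (\row_j if j == i then c else a 0 j)%R.
have -> : E `&` halfspace i c = box a b'.
  rewrite Eab; apply/seteqP; split => [x [abx xc] j|x abx].
    have /andP[-> xb] := abx j; rewrite mxE.
    by case: eqP => //= ->.
  split => [j|]; last by have /andP[_] := abx i; rewrite mxE eqxx.
  have := abx j; rewrite mxE; case: eqP => [->|//] /andP[-> /=].
  by move=> /lt_trans; exact.
have -> : E `&` ~` halfspace i c = box a' b.
  rewrite Eab; apply/seteqP; split => [x [abx /negP]|x abx].
    rewrite -leNgt => cx j.
    have /andP[ax ->] := abx j; rewrite mxE andbT.
    by case: eqP => // ->.
  split => [j|]; last first.
    by have /andP[+ _] := abx i; rewrite mxE eqxx /halfspace /= leNgt => /negP.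
  have := abx j; rewrite mxE; case: eqP => [->|//] /andP[+ ->]; rewrite andbT.
  by move=> /(lt_le_trans ac)/ltW.
have ab'_le j : (a 0 j <= b' 0 j)%R by rewrite mxE; case: eqP => // ->; exact: ltW.
have a'b_le j : (a' 0 j <= b 0 j)%R by rewrite mxE; case: eqP => // ->; exact: ltW.
apply: le_trans (leeD (box_weight_le ab'_le) (box_weight_le a'b_le)) _.
rewrite -EFinD lee_fin le_eqVlt; apply/orP; left; apply/eqP.
rewrite [X in (X + _)%R](bigD1 i)// [X in (_ + X)%R](bigD1 i)//.
rewrite [RHS](bigD1 i)//= !mxE eqxx.
rewrite (eq_bigr (fun j => b 0 j - a 0 j)%R); last first.
  by move=> j ji; rewrite mxE (negPf ji).
rewrite [X in (_ + _ * X)%R](eq_bigr (fun j => b 0 j - a 0 j)%R); last first.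
  by move=> j ji; rewrite mxE (negPf ji).
ring.
Qed.

(** Cutting every member of a cover of [X] along the hyperplane yields covers of the two parts of
    [X] with no larger total weight. *)
Lemma caratheodory_halfspace i c :
  caratheodory_measurable (@lebesgue_outer R d) (halfspace i c).
Proof.
apply: (le_caratheodory_measurable (mu := @lebesgue_outer R d)) => X.
apply: le_ereal_inf_tmp => _ [F [_ XF] <-].
apply: (@le_trans _ _ (\sum_(k <oo) (box_weight (F k `&` halfspace i c) +
    box_weight (F k `&` ~` halfspace i c)))); last first.
  apply: lee_nneseries => k _ *; last exact: box_weight_halfspace.
  by rewrite adde_ge0// box_weight_ge0.
rewrite nneseriesD; try by move=> *; exact: box_weight_ge0.
apply: leeD; apply: ereal_inf_lbound.
  exists (fun k => F k `&` halfspace i c) => //; split => // x [/XF[k _ Fkx] xc].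
  by exists k.
exists (fun k => F k `&` ~` halfspace i c) => //; split => // x [/XF[k _ Fkx] xc].
by exists k.
Qed.

End box_weight.

(** * Measurability of open sets and translation invariance of the integral *)

Section lebesgue_measurability.
Context (R : realType) (d : nat).
Local Notation Rd := 'rV[R]_d.
Local Notation Ld := (caratheodory_type (@lebesgue_outer R d)).
Implicit Types (x y : Rd) (i : 'I_d) (U : set Rd).

Lemma measurable_coord i : measurable_fun (setT : set Ld) (fun x : Ld => x 0 i).
Proof.
apply: (measurability _ (RGenInftyO.measurableE R)) => _ [_ [c ->] <-].
rewrite setTI; rewrite (_ : _ @^-1` _ = halfspace i c).
  exact: caratheodory_halfspace.
by apply/seteqP; split => x /=; rewrite in_itv.
Qed.

(** Rational corners keep the boxes countable: they generate the open sets here and index the cutoff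
    functions later. The closed version below is the compact set that carries the support of a
    bump. *)
Definition obox (p : 'rV[rat]_d * 'rV[rat]_d) : set Rd :=
  [set x | forall i, ratr (p.1 0 i) < x 0 i < ratr (p.2 0 i)].

Definition cbox (p : 'rV[rat]_d * 'rV[rat]_d) : set Rd :=
  [set x | forall i, ratr (p.1 0 i) <= x 0 i <= ratr (p.2 0 i)].

Lemma measurable_obox p : measurable (obox p : set Ld).
Proof.
rewrite (_ : obox p = \bigcap_(i in [set: 'I_d])
    ((fun x : Ld => x 0 i) @^-1` `]ratr (p.1 0 i), ratr (p.2 0 i)[)).
  apply: fin_bigcap_measurable => // i _.
  by rewrite -[_ @^-1` _]setTI; apply: measurable_coord.
apply/seteqP; split => [x px i _|x px i]; first by rewrite /= in_itv; exact: px.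
by have := px i I; rewrite /= in_itv.
Qed.

(** Balls of the sup norm are cubes, so rational endpoints chosen within distance [e] on either side
    of each coordinate give a closed box inside the ball. *)
Lemma open_obox U x : open U -> U x -> exists p, obox p x /\ cbox p `<=` U.
Proof.
move=> oU Ux; have /nbhs_ballP[e e0 xeU] := open_nbhs_nbhs (conj oU Ux).
have lo i : exists q : rat, x 0 i - e < ratr q < x 0 i.
  by have [|q] := @rat_in_itvoo R (x 0 i - e) (x 0 i); [rewrite gtrBl|exists q].
have hi i : exists q : rat, x 0 i < ratr q < x 0 i + e.
  by have [|q] := @rat_in_itvoo R (x 0 i) (x 0 i + e); [rewrite ltrDl|exists q].
pose lo' i := projT1 (cid (lo i)); pose hi' i := projT1 (cid (hi i)).
exists (\row_i lo' i, \row_i hi' i); split.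
  move=> i; rewrite !mxE /lo' /hi'.
  by case: cid => /= q /andP[_ ->]; case: cid => /= q' /andP[].
move=> y py; apply: xeU; split => // i j; rewrite (ord1 i).
have := py j; rewrite !mxE /lo' /hi'.
case: cid => /= q /andP[q1 _]; case: cid => /= q' /andP[_ q2] /andP[y1 y2].
rewrite /ball /= ltr_distl; apply/andP; split.
  by rewrite ltrBlDr (le_lt_trans y2)// .
by rewrite -ltrBlDr (lt_le_trans q1).
Qed.

Lemma open_measurableL U : open U -> measurable (U : set Ld).
Proof.
move=> oU; rewrite (_ : U = \bigcup_(p in [set p | cbox p `<=` U]) obox p).
  rewrite bigcup_mkcond; apply: countable_bigcupT_measurable.
    exact: countableP.
  by move=> p; case: ifP => // _; exact: measurable_obox.
apply/seteqP; split => [x Ux|x [p pU px]].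
  by have [p [px pU]] := open_obox oU Ux; exists p.
by apply: pU => i; have /andP[/ltW -> /ltW ->] := px i.
Qed.

Lemma continuous_measurableL (f : Rd -> R) : continuous f ->
  measurable_fun (setT : set Ld) (f : Ld -> R).
Proof.
move=> cf; apply: (measurability _ (RGenInftyO.measurableE R)) => _ [_ [c ->] <-].
rewrite setTI; apply: open_measurableL.
by apply: (open_comp (f := f)) => [x _|]; [exact: cf|exact: interval_open].
Qed.

(** Translating the test set along with [A] turns the Caratheodory criterion for the preimage into
    the one for [A]. *)
Lemma measurable_translation y :
  measurable_fun (setT : set Ld) (fun x : Ld => (x + y : Ld)).
Proof.
move=> _ A mA; rewrite setTI.
have {}mA : caratheodory_measurable (@lebesgue_outer R d) A := mA.
suff : caratheodory_measurable (@lebesgue_outer R d)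
  ((fun x : Rd => x + y) @^-1` A) by [].
move=> X.
have tr B : lebesgue_outer (B `&` (fun x => x + y) @^-1` A) =
    lebesgue_outer ((fun x => x - y) @^-1` B `&` A).
  rewrite -(lebesgue_outer_translation y (_ `&` A)) preimage_setI.
  congr (lebesgue_outer (_ `&` _)).
  by apply/seteqP; split => x /=; rewrite addrK.
have trC B : lebesgue_outer (B `&` ~` ((fun x => x + y) @^-1` A)) =
    lebesgue_outer ((fun x => x - y) @^-1` B `&` ~` A).
  rewrite -(lebesgue_outer_translation y (_ `&` ~` A)) preimage_setI.
  congr (lebesgue_outer (_ `&` _)).
  by apply/seteqP; split => x /=; rewrite addrK.
by rewrite tr trC -mA lebesgue_outer_translation.
Qed.

(** Change of variables for the push-forward under translation, which invariance of the outer
    measure identifies with the measure itself. *)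
Lemma integral_translation y (f : Rd -> \bar R) :
  measurable_fun (setT : set Ld) (f : Ld -> \bar R) ->
  (leb R d).-integrable setT (f \o (fun x : Rd => x + y)) ->
  (\int[leb R d]_x (f \o (fun x : Rd => x + y)%R) x = \int[leb R d]_x f x)%E.
Proof.
move=> mf intf; have mt := measurable_translation y.
have := integral_pushforward mt mf (D := setT) intf measurableT.
rewrite preimage_setT => <-; apply: eq_measure_integral => A mA _.
exact: lebesgue_outer_translation.
Qed.

Lemma bounded_lebesgue_lty (A : set Rd) : bounded_set A -> (leb R d A < +oo)%E.
Proof.
(* [bounded_set] bounds the norm only by numbers above M, hence M + 1; one more unit keeps the
   points strictly below the excluded upper faces of the half-open box. *)
move=> [M [_ AM]]; pose c : Rd := const_mx (M + 2).
apply: (@le_lt_trans _ _ (lebesgue_outer (box (- c) c))); last first.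
  exact: lebesgue_outer_box_lty.
apply: le_lebesgue_outer => x Ax i.
have xM : `|x 0 i| <= M + 1.
  apply: le_trans (AM _ _ x Ax); last by rewrite ltrDl.
  exact: le_coord_norm.
rewrite !mxE; move: xM; rewrite ler_norml => /andP[? ?].
by apply/andP; split; lra.
Qed.

End lebesgue_measurability.

(** * Integration by parts and test functions *)

Section smooth_integrals.
Context (R : realType) (d : nat).
Local Notation Rd := 'rV[R]_d.
Local Notation Ld := (caratheodory_type (@lebesgue_outer R d)).
Local Notation mu := (leb R d).
Implicit Types (f g phi : Rd -> R) (x v : Rd) (i : 'I_d) (Om : set Rd).

Definition bounded_support f := exists M, forall x, M < `|x| -> f x = 0.

Lemma compact_normed_ball M : compact [set x : Rd | `|x| <= M].
Proof.
apply: bounded_closed_compact.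
  exists M; split; first exact: num_real.
  by move=> e Me x /= /le_trans; apply; exact: ltW.
apply: (@closed_comp _ _ (Num.norm : Rd -> R) [set r | r <= M]).
  by move=> x _; exact: norm_continuous.
exact: closed_le.
Qed.

Lemma continuous_bounded_ball f M : continuous f ->
  exists B, forall x, `|x| <= M -> `|f x| <= B.
Proof.
move=> cf; have := @continuous_compact _ _ f [set x : Rd | `|x| <= M]
  (continuous_subspaceT cf) (@compact_normed_ball M).
move=> /compact_bounded[B [_ HB]]; exists (B + 1) => x xM.
by apply: (HB (B + 1)); [rewrite ltrDl|exists x].
Qed.

Lemma measurable_normed_ball M : measurable ([set x : Rd | `|x| <= M] : set Ld).
Proof.
have := continuous_measurableL (@norm_continuous _ Rd) measurableT
  (measurable_itv `]-oo, M]).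
by rewrite setTI; congr measurable.
Qed.

Lemma normed_ball_lty M : (mu [set x : Rd | (`|x| <= M)%R] < +oo)%E.
Proof.
apply: bounded_lebesgue_lty; exists M; split; first exact: num_real.
by move=> e Me x /= /le_trans; apply; exact: ltW.
Qed.

Lemma integrable_cst_ball M B :
  mu.-integrable setT ((cst B%:E) \_ [set x : Rd | `|x| <= M]).
Proof.
apply/(integrable_mkcond _ (measurable_normed_ball M)).
apply: (@measurable_bounded_integrable _ _ _ _ (cst B)).
- exact: measurable_normed_ball.
- exact: normed_ball_lty.
- exact: measurable_cst.
- by exists `|B|; split; [exact: num_real|move=> e /ltW Be x _ /=].
Qed.

Lemma integrable_bounded_support f : continuous f -> bounded_support f ->
  mu.-integrable setT (EFin \o f).
Proof.
move=> cf [M fM]; have [B fB] := continuous_bounded_ball M cf.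
apply: (le_integrable measurableT _ _ (integrable_cst_ball M B)).
  exact/measurable_EFinP/continuous_measurableL.
move=> x _; rewrite patchE; have [xM|xM] := leP `|x| M.
  by rewrite mem_set//= lee_fin (le_trans (fB _ xM))// ler_norm.
rewrite memNset/=; last by move=> /(lt_le_trans xM); rewrite ltxx.
by rewrite fM// normr0.
Qed.

Lemma is_derive_line f v x t : (forall y, derivable f y v) ->
  is_derive t (1 : R) (fun s : R => f (s *: v + x)) ('D_v f (t *: v + x)).
Proof.
move=> df; pose g (s : R) := f (s *: v + x).
have quotient :
    (fun h : R => h^-1 *: ((f \o shift (t *: v + x)) (h *: v) - g t)) =
    (fun h : R => h^-1 *: ((g \o shift t) (h *: 1) - g t)).
  by apply/funext => h /=; rewrite /g [h%:A]mulr1 scalerDl addrA.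
split; first by rewrite /derivable -quotient; exact: df.
by rewrite /derive -quotient.
Qed.

Lemma norm_delta_le1 i : `|delta_mx 0 i : Rd| <= 1.
Proof.
rewrite [leLHS]/Num.norm /= mx_normrE; apply/bigmax_leP; split => // -[a b] _ /=.
by rewrite !mxE; case: (_ && _); rewrite ?normr1 ?normr0.
Qed.

(** Mean value theorem on the segment from x to x + h e_i, whose points have norm at most [M + 1]
    because h <= 1 and e_i has norm at most 1. *)
Lemma difference_quotient_le i f B M x (h : R) : 0 < h <= 1 ->
  (forall y, derivable f y (delta_mx 0 i)) ->
  (forall y, `|y| <= M + 1 -> `|partial i f y| <= B) -> `|x| <= M ->
  `|h^-1 * (f (h *: delta_mx 0 i + x) - f x)| <= B.
Proof.
move=> /andP[h0 h1] df fB xM; set v := delta_mx 0 i.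
have dline t := @is_derive_line f v x t df.
have [|c] := @MVT R _ _ 0 h h0 (fun t _ => dline t).
  apply: continuous_subspaceT => t.
  have [dt _] := dline t.
  exact/differentiable_continuous/derivable1_diffP.
rewrite in_itv/= => /andP[c0 ch]; rewrite scale0r add0r subr0 => ->.
rewrite mulrC mulfK ?gt_eqF//; apply: fB.
apply: le_trans (ler_normD _ _) _; rewrite addrC lerD// normrZ.
rewrite ger0_norm ?(ltW c0)// -[leRHS]mulr1 ler_pM ?norm_delta_le1 ?(ltW c0)//.
by rewrite (le_trans (ltW ch)).
Qed.

Lemma cvg_difference_quotient i f x : derivable f x (delta_mx 0 i) ->
  n.+1%:R * (f (n.+1%:R^-1 *: delta_mx 0 i + x) - f x) @[n --> \oo] --> partial i f x.
Proof.
move=> df; have /cvgr_dnbhsP/(_ harmonic) : (fun h : R => h^-1 *: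
    ((f \o shift x) (h *: delta_mx 0 i) - f x)) @ 0^' --> partial i f x.
  exact: df.
rewrite /harmonic /= => cv.
have := cv (conj (fun n => _) cvg_harmonic).
under eq_fun do rewrite invrK.
by apply=> n; rewrite invr_eq0 pnatr_eq0.
Qed.

(* The difference quotients of f have integral 0 by translation invariance, and
   they converge dominatedly to the partial derivative: no Fubini is needed. *)
Lemma integral_partial_eq0 i f : Ck 1 f -> bounded_support f ->
  mu.-integrable setT (EFin \o partial i f) /\ \int[mu]_x partial i f x = 0.
Proof.
move=> [cf /(_ i)[df [cdf _]]] fs; have [M fM] := fs.
(* Difference quotients of step at most 1 vanish where |x| > |M| + 1, and within that radius the
   mean value theorem evaluates the derivative up to one unit further, whence |M| + 2. *)
pose N : R := `|M| + 2; have [B0 fB0] := continuous_bounded_ball N cdf.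
pose B : R := `|B0|.
pose D n (x : Rd) := n.+1%:R * (f (n.+1%:R^-1 *: delta_mx 0 i + x) - f x).
have invn n : 0 < (n.+1%:R^-1 : R) <= 1.
  by rewrite invr_gt0 ltr0n/= invf_le1// ler1n.
have cD n : continuous (fun x : Rd => f (n.+1%:R^-1 *: delta_mx 0 i + x)).
  move=> x; apply: continuous_comp; last exact: cf.
  by apply: continuousD; [exact: cst_continuous|exact: cvg_id].
have normv n x : `|M| + 1 < `|x| -> `|M| < `|n.+1%:R^-1 *: delta_mx 0 i + x|.
  move=> Mx; have le1 : `|n.+1%:R^-1 *: (delta_mx 0 i : Rd)| <= 1.
    have /andP[n0 n1] := invn n.
    rewrite normrZ ger0_norm ?(ltW n0)// -[leRHS]mulr1.
    by rewrite ler_pM ?norm_delta_le1 ?(ltW n0).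
  have := ler_normB (n.+1%:R^-1 *: (delta_mx 0 i : Rd) + x)
    (n.+1%:R^-1 *: delta_mx 0 i).
  rewrite addrAC subrr add0r => ?; lra.
have iD n : mu.-integrable setT
    (EFin \o (fun x : Rd => f (n.+1%:R^-1 *: delta_mx 0 i + x))).
  apply: integrable_bounded_support => //; exists (`|M| + 1) => x Mx.
  by apply: fM; rewrite (le_lt_trans (ler_norm M))// normv.
have if_ := integrable_bounded_support cf fs.
have intD n : (\int[mu]_x (D n x)%:E = 0)%E.
  rewrite /D; under eq_integral do rewrite EFinM.
  rewrite integralZl//; last exact: (integrableB _ (iD n) if_).
  rewrite integralB_EFin//.
  have compE : (EFin \o f) \o (fun x => x + n.+1%:R^-1 *: delta_mx 0 i) =
      EFin \o (fun x => f (n.+1%:R^-1 *: delta_mx 0 i + x)).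
    by apply/funext => x /=; rewrite addrC.
  have mf : measurable_fun (setT : set Ld) (EFin \o f : Ld -> \bar R).
    exact/measurable_EFinP/continuous_measurableL.
  have := @integral_translation R d (n.+1%:R^-1 *: delta_mx 0 i) (EFin \o f) mf.
  rewrite compE => /(_ (iD n)) /= ->.
  by rewrite subee ?mule0//; exact: integrable_fin_num if_.
have DB n x : (`|(D n x)%:E| <= ((cst B%:E) \_ [set x : Rd | (`|x| <= N)%R]) x)%E.
  rewrite patchE; have [xN|xN] := leP `|x| (`|M| + 1).
    rewrite mem_set/=; last by rewrite /N; lra.
    rewrite lee_fin /D -[X in X * _]invrK.
    apply: (@difference_quotient_le i f B (`|M| + 1)) => //.
    by move=> y yM; rewrite /B (le_trans (fB0 _ _)) ?ler_norm// /N; lra.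
  rewrite /D (fM x) ?(fM (_ + x)).
  - by rewrite subrr mulr0 /= normr0; case: ifP; rewrite /= ?lee_fin ?normr_ge0.
  - by rewrite (le_lt_trans (ler_norm M))// normv.
  - by rewrite (le_lt_trans (ler_norm M))//; lra.
have [] := @dominated_convergence _ _ R mu setT measurableT (fun n x => (D n x)%:E)
  (EFin \o partial i f) ((cst B%:E) \_ [set x : Rd | `|x| <= N]).
- move=> n; apply/measurable_EFinP/continuous_measurableL => x; rewrite /D.
  apply: (@continuousM _ _ (cst n.+1%:R) (fun x => _ - f x)).
    exact: cst_continuous.
  by apply: continuousB; [exact: cD|exact: cf].
- exact/measurable_EFinP/continuous_measurableL.
- apply: aeW => x _; apply/cvg_EFin; first exact: nearW.
  exact: cvg_difference_quotient.
- exact: integrable_cst_ball.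
- by apply: aeW => x n _; exact: DB.
move=> ip _ cv; split => //; rewrite /Rintegral.
suff -> : (\int[mu]_x (partial i f x)%:E = 0)%E by [].
move: cv; rewrite (_ : [sequence _]_n = cst 0%E); last first.
  by apply/funext => n; exact: intD.
by move=> cv; apply: (cvg_unique (@ereal_hausdorff R) cv (cvg_cst _)).
Qed.

End smooth_integrals.

(** * Test functions as elements of H^1 with zero trace *)

Section test_functions.
Context (R : realType) (d : nat).
Local Notation Rd := 'rV[R]_d.
Local Notation Ld := (caratheodory_type (@lebesgue_outer R d)).
Local Notation mu := (leb R d).
Implicit Types (f g phi psi : Rd -> R) (x : Rd) (i : 'I_d) (Om : set Rd).

Lemma Cinfty_continuous phi : Cinfty phi -> continuous phi.
Proof. by move=> /(_ 0%N)[]. Qed.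

Lemma Cinfty_derivable phi i x : Cinfty phi -> derivable phi x (delta_mx 0 i).
Proof. by move=> /(_ 1%N)[_ /(_ i)[]]. Qed.

Lemma Cinfty_partial phi i : Cinfty phi -> Cinfty (partial i phi).
Proof. by move=> Cphi k; have [_ /(_ i)[]] := Cphi k.+1. Qed.

Lemma CinftyM phi psi : Cinfty phi -> Cinfty psi -> Cinfty (phi \* psi).
Proof. by move=> Cphi Cpsi k; exact: CkM. Qed.

Lemma test_function_out Om phi x : test_function Om phi -> ~ Om x -> phi x = 0.
Proof.
move=> [_ _ sOm] nOm; apply/eqP/negPn/negP => phi0.
by apply/nOm/sOm/subset_closure.
Qed.

Lemma test_function_bounded_support Om phi :
  test_function Om phi -> bounded_support phi.
Proof.
move=> [_ /compact_bounded[M [_ HM]] _]; exists (M + 1) => x xM.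
apply/eqP/negPn/negP => phi0.
have : `|x| <= M + 1 by apply: (HM (M + 1)); [rewrite ltrDl|exact: subset_closure].
by rewrite leNgt xM.
Qed.

(** The common reason why derivatives and smooth multiples stay test functions: the support of [psi]
    is a closed subset of the compact support of [phi]. *)
Lemma test_function_sub Om phi psi : test_function Om phi -> Cinfty psi ->
  (forall x, psi x != 0 -> closure [set x | phi x != 0] x) ->
  test_function Om psi.
Proof.
move=> [_ cphi sphi] Cpsi sub.
have clsub : closure [set x | psi x != 0] `<=` closure [set x | phi x != 0].
  rewrite [X in _ `<=` X](closure_id _).1; first exact: closureS.
  exact: closed_closure.
split => //; last exact: subset_trans clsub sphi.
by apply: (subclosed_compact _ cphi) => //; exact: closed_closure.
Qed.

Lemma test_function_partial Om phi i : test_function Om phi ->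
  test_function Om (partial i phi).
Proof.
move=> tphi; have [Cphi _ _] := tphi.
apply: test_function_sub tphi (Cinfty_partial i Cphi) _ => x dphi0.
apply: contrapT => nx; move/eqP: dphi0; apply.
rewrite /partial (@near_eq_derive _ _ _ phi (cst 0)) ?derive_cst//.
(* Off its closed support [phi] vanishes on a neighbourhood, so its derivative there is that of
   0. *)
have oC : open (~` closure [set x | phi x != 0]).
  by apply: closed_openC; exact: closed_closure.
have /= := open_nbhs_nbhs (conj oC nx).
apply: filterS => y ny; apply/eqP/negPn/negP => phi0.
by apply: ny; exact: subset_closure.
Qed.

Lemma test_functionMl Om f phi : Cinfty f -> test_function Om phi ->
  test_function Om (f \* phi).
Proof.
move=> Cf tphi; have [Cphi _ _] := tphi.
apply: test_function_sub tphi _ _; first exact: CinftyM.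
by move=> x /=; rewrite mulf_eq0 negb_or => /andP[_ ?]; exact: subset_closure.
Qed.

Lemma measurable_continuousL Om f : measurable (Om : set Ld) -> continuous f ->
  measurable_fun (Om : set Ld) (f : Ld -> R).
Proof. by move=> mOm cf; exact/measurable_funTS/continuous_measurableL. Qed.

Lemma bounded_support_Lp2 Om f : measurable (Om : set Ld) ->
  continuous f -> bounded_support f -> Lp mu Om 2%:E f.
Proof.
move=> mOm cf [M fM]; apply/Lp2P => //; split; first exact: measurable_continuousL.
apply: (@integrableS _ _ _ mu setT) => //.
apply: (@integrable_bounded_support _ _ (fun x => f x ^+ 2)).
  by move=> x; apply: (@continuousM _ _ f f); exact: cf.
by exists M => x /fM ->; rewrite expr0n.
Qed.

Lemma test_function_Lp2 Om phi : measurable (Om : set Ld) ->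
  test_function Om phi -> Lp mu Om 2%:E phi.
Proof.
move=> mOm tphi; apply: bounded_support_Lp2 => //.
  by case: tphi => /Cinfty_continuous.
exact: test_function_bounded_support tphi.
Qed.

(** Leibniz rule for the product of [phi] with a test function, whose partial derivative has
    integral 0. The test function vanishes outside [Om], so all the integrals may be taken over the
    whole space. *)
Lemma weak_gradient_smooth Om phi : Cinfty phi ->
  weak_gradient Om phi (grad_of phi).
Proof.
move=> Cphi i psi tpsi; have [Cpsi _ _] := tpsi.
have tdpsi := test_function_partial i tpsi.
have tprod f g : Cinfty f -> test_function Om g ->
    mu.-integrable setT (EFin \o (f \* g)).
  move=> Cf tg; have tfg := test_functionMl Cf tg.
  apply: integrable_bounded_support; last exact: test_function_bounded_support tfg.
  by case: tfg => /Cinfty_continuous.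
have restrict_test f g : test_function Om g -> (f \* g) \_ Om = f \* g.
  move=> tg; apply/funext => x; rewrite patchE; case: ifPn => //.
  by rewrite notin_setE => /(test_function_out tg)/= ->; rewrite mulr0.
have -> : ip Om phi (partial i psi) = \int[mu]_x (phi x * partial i psi x).
  by rewrite /ip Rintegral_mkcond; congr (Rintegral _ _ _); exact: restrict_test.
have -> : ip Om (fun x => grad_of phi x 0 i) psi = \int[mu]_x (partial i phi x * psi x).
  rewrite (_ : (fun x => _) = partial i phi); last by apply/funext => x; rewrite mxE.
  by rewrite /ip Rintegral_mkcond; congr (Rintegral _ _ _); exact: restrict_test.
apply/eqP; rewrite -subr_eq0 opprK; apply/eqP.
rewrite -RintegralD//.
- have [_] := @integral_partial_eq0 R d i (phi \* psi)
    (CkM (Cphi 1%N) (Cpsi 1%N))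
    (test_function_bounded_support (test_functionMl Cphi tpsi)).
  rewrite partialM; try by move=> x; exact: Cinfty_derivable.
  move=> int0; rewrite -[RHS]int0; apply: eq_Rintegral => x _ /=.
  by rewrite [psi x * _]mulrC.
- exact: tprod.
- by apply: tprod => //; exact: Cinfty_partial.
Qed.

(** Admits test functions into the weak equations. The open set [Om] misses its boundary, so the
    constant sequence [phi] witnesses the trace 0. *)
Lemma test_function_H1 Om phi : open Om -> test_function Om phi ->
  exists s : H1 Om, [/\ H1fun s = phi, grad s = grad_of phi & trace s = fun=> 0].
Proof.
move=> oOm tphi; have mOm := open_measurableL oOm.
have [Cphi _ _] := tphi.
have gradE i : (fun x => grad_of phi x 0 i) = partial i phi.
  by apply/funext => x; rewrite mxE.
have gL2 : L2v Om (grad_of phi).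
  by move=> i; rewrite gradE; exact/test_function_Lp2/test_function_partial.
have tr : has_trace Om phi (grad_of phi) (fun=> 0).
  exists (fun=> phi); split => //.
  - exact: L2_cvg_cst.
  - by move=> i; apply: L2_cvg_cst => x _; rewrite mxE.
  - apply: L2_cvg_cst => x [_ nx]; apply: (test_function_out tphi) => Ox.
    by apply: nx; exact: open_nbhs_nbhs.
by exists (MkH1 (test_function_Lp2 mOm tphi) gL2 (weak_gradient_smooth Cphi)
  (Lp0 _ _ (le1_2e R)) tr).
Qed.

End test_functions.

(** * Cutoff functions and uniqueness of the weak divergence *)

Section cutoff.
Context (R : realType) (d : nat).
Local Notation Rd := 'rV[R]_d.
Local Notation Ld := (caratheodory_type (@lebesgue_outer R d)).
Local Notation mu := (leb R d).
Implicit Types (x : Rd) (p : 'rV[rat]_d * 'rV[rat]_d) (m n : nat).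

Lemma flat_exp0_le1 (t : R) : flat_exp 0 t <= 1.
Proof.
rewrite /flat_exp; case: ifPn => // t0.
by rewrite expr0 invr1 mul1r expR_le1 oppr_le0 invr_ge0 ltW.
Qed.

Lemma cvg_flat_exp0 (t : R) : 0 < t -> flat_exp 0 (n%:R * t) @[n --> \oo] --> (1 : R).
Proof.
move=> t0; rewrite -(cvg_shiftn 1)/=.
rewrite (_ : (fun n => _) = (fun n => expR (- (n.+1%:R^-1 * t^-1)))); last first.
  apply/funext => n; rewrite /flat_exp addn1 mulr_gt0// expr0 invr1 mul1r.
  by rewrite invfM.
have cv0 : - (n.+1%:R^-1 * t^-1) @[n --> \oo] --> - (0 * t^-1).
  by apply: cvgN; apply: cvgM; [exact: cvg_harmonic|exact: cvg_cst].
rewrite mul0r oppr0 in cv0.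
have := continuous_cvg _ (@continuous_expR R 0) cv0.
by rewrite expR0; apply.
Qed.

(** As exp(-1/(n s)) tends to 1 for s > 0, scaling the signed distances to the faces by n makes
    these bumps converge to the indicator of the open box. The arguments are written as a x_i + b to
    match [Ck_flat_exp]. *)
Definition bump n p x : R := \prod_(i < d)
  (flat_exp 0 (n%:R * x 0 i + - (n%:R * ratr (p.1 0 i))) *
   flat_exp 0 (- n%:R * x 0 i + n%:R * ratr (p.2 0 i))).

Lemma Ck_bump k n p : Ck k (bump n p).
Proof. by apply: Ck_prod => i; apply: CkM; exact: Ck_flat_exp. Qed.

Lemma bump_ge0 n p x : 0 <= bump n p x.
Proof. by apply: prodr_ge0 => i _; rewrite mulr_ge0// flat_exp_ge0. Qed.

Lemma bump_le1 n p x : bump n p x <= 1.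
Proof.
apply: prodr_ile1 => i _.
by rewrite mulr_ge0 ?flat_exp_ge0//= mulr_ile1 ?flat_exp_ge0 ?flat_exp0_le1.
Qed.

Lemma bump_neq0 n p x : bump n p x != 0 -> obox p x.
Proof.
move=> /prodf_neq0 h i; have := h i isT; rewrite mulf_eq0 negb_or => /andP[].
rewrite -mulrBr mulNr [- _ + _]addrC -mulrBr /flat_exp.
case: ifPn => [n1 _|]; last by rewrite eqxx.
case: ifPn => [n2 _|]; last by rewrite eqxx.
have n0 : 0 <= (n%:R : R) by [].
have pos (t : R) : 0 < n%:R * t -> 0 < t.
  by move=> nt; rewrite ltNge; apply/negP => t0; move: nt; rewrite ltNge mulr_ge0_le0.
by rewrite -subr_gt0 (pos _ n1) -subr_gt0 (pos _ n2).
Qed.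

Lemma cvg_bump p x : obox p x -> bump n p x @[n --> \oo] --> (1 : R).
Proof.
move=> px; rewrite /bump; elim: (index_enum _) => [|i s ih].
  by under eq_fun do rewrite big_nil; exact: cvg_cst.
under eq_fun do rewrite big_cons.
have /andP[x1 x2] := px i.
have c1 : flat_exp 0 (n%:R * x 0 i + - (n%:R * ratr (p.1 0 i))) @[n --> \oo] --> (1 : R).
  under eq_fun do rewrite -mulrBr.
  by apply: cvg_flat_exp0; rewrite subr_gt0.
have c2 : flat_exp 0 (- n%:R * x 0 i + n%:R * ratr (p.2 0 i)) @[n --> \oo] --> (1 : R).
  under eq_fun do rewrite mulNr addrC -mulrBr.
  by apply: cvg_flat_exp0; rewrite subr_gt0.
by have := cvgM (cvgM c1 c2) ih; rewrite !mulr1; exact.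
Qed.

Lemma compact_cbox p : compact (cbox p : set Rd).
Proof.
have := @rV_compact R d (fun i => `[ratr (p.1 0 i) : R, ratr (p.2 0 i)]%classic)
  (fun i => @segment_compact R _ _).
by congr compact; apply/seteqP; split => x /= h i; have := h i; rewrite in_itv.
Qed.

Variable Om : set Rd.

(* [k] enumerates the rational boxes; only those inside [Om] contribute. *)
Definition cut_bump m k x : R :=
  if unpickle k is Some p then if `[< cbox p `<=` Om >] then bump m p x else 0
  else 0.

Definition cut_box k : set Rd :=
  if unpickle k is Some p then if `[< cbox p `<=` Om >] then cbox p else set0
  else set0.

(** A smooth substitute for the maximum of the first m bumps: it stays in [0, 1], is at least each
    of them, and vanishes where they all do. The index m is both the number of boxes and the
    sharpness of the bumps. *)
Definition cutoff m x : R := 1 - \prod_(k < m) (1 - cut_bump m k x).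

Lemma cut_bump_itv m k x : 0 <= 1 - cut_bump m k x <= 1.
Proof.
rewrite subr_ge0 gerBl /cut_bump; case: unpickle => [p|]; last by rewrite ler01 lexx.
by case: ifPn; rewrite ?bump_le1 ?bump_ge0// ler01 lexx.
Qed.

Lemma cutoff_itv m x : 0 <= cutoff m x <= 1.
Proof.
rewrite /cutoff subr_ge0 gerBl prodr_ile1 => [|i _]; last exact: cut_bump_itv.
by apply: prodr_ge0 => i _; have /andP[] := cut_bump_itv m i x.
Qed.

Lemma Cinfty_cutoff m : Cinfty (cutoff m).
Proof.
move=> k; rewrite (_ : cutoff m =
    cst 1 \+ (fun x => -1 * \prod_(j < m) (1 - cut_bump m j x))).
  apply: CkD; first exact: Ck_cst.
  apply: CkZ; apply: Ck_prod => j.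
  rewrite (_ : (fun x => 1 - cut_bump m j x) =
      cst 1 \+ (fun x => -1 * cut_bump m j x)).
    apply: CkD; first exact: Ck_cst.
    apply: CkZ; rewrite /cut_bump; case: unpickle => [p|]; last exact: Ck_cst.
    by case: asboolP => _; [exact: Ck_bump|exact: Ck_cst].
  by apply/funext => x /=; rewrite mulN1r.
by apply/funext => x /=; rewrite mulN1r.
Qed.

Lemma test_function_cutoff m : test_function Om (cutoff m).
Proof.
(* The support lies in a finite union of compact closed boxes, each contained in [Om]. *)
pose K : set Rd := \big[setU/set0]_(k < m) cut_box k.
have cK : compact K.
  apply: bigsetU_compact => k _; rewrite /cut_box.
  case: unpickle => [p|]; last exact: compact0.
  by case: ifPn => _; [exact: compact_cbox|exact: compact0].
have KOm : K `<=` Om.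
  rewrite /K -bigcup_mkord => x [k _]; rewrite /cut_box.
  by case: unpickle => [p|//]; case: ifPn => // /asboolP; exact.
have clK : closure [set x | cutoff m x != 0] `<=` K.
  rewrite [X in _ `<=` X](closure_id _).1; last first.
    by apply: compact_closed cK; exact: norm_hausdorff.
  apply: closureS => x /= chi0; apply: contrapT => nKx.
  move/eqP: chi0; apply; rewrite /cutoff big1 ?subrr// => k _.
  rewrite (_ : cut_bump m k x = 0) ?subr0//; apply/eqP/negPn/negP => ck0.
  apply: nKx; rewrite /K -bigcup_mkord; exists k => //=.
  move: ck0; rewrite /cut_bump /cut_box; case: unpickle => [p|]; last by rewrite eqxx.
  case: ifPn => [_ /bump_neq0 px|_]; last by rewrite eqxx.
  by move=> i; have /andP[/ltW -> /ltW ->] := px i.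
split; [exact: Cinfty_cutoff| |exact: subset_trans clK KOm].
by apply: (subclosed_compact _ cK) => //; exact: closed_closure.
Qed.

(** Some admissible box [p] contains x; once m exceeds its code, the cutoff is squeezed between
    [bump m p x] and 1. *)
Lemma cvg_cutoff x : open Om -> Om x -> cutoff m x @[m --> \oo] --> (1 : R).
Proof.
move=> oOm Omx; have [p [px pOm]] := open_obox oOm Omx.
apply: (@squeeze_cvgr _ _ _ _ (fun m => bump m p x) (cst 1)); last 2 first.
- exact: cvg_bump.
- exact: cvg_cst.
near=> m; have /andP[_ ->] := cutoff_itv m x; rewrite andbT.
have km : (pickle p < m)%N by near: m; exact: nbhs_infty_gt.
rewrite /cutoff lerBrDl -lerBrDr (bigD1 (Ordinal km))//= {1}/cut_bump pickleK.
rewrite asboolT// ler_piMr ?subr_ge0 ?bump_le1//.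
by apply: prodr_ile1 => k _; exact: cut_bump_itv.
Unshelve. all: by end_near. Qed.

End cutoff.

(** * L^2 pairings and functions orthogonal to all test functions *)

Section weak_divergence.
Context (R : realType) (d : nat).
Local Notation Rd := 'rV[R]_d.
Local Notation Ld := (caratheodory_type (@lebesgue_outer R d)).
Local Notation mu := (leb R d).
Variable Om : set Rd.
Hypothesis oOm : open Om.
Implicit Types (f g h r phi : Rd -> R) (F G : Rd -> Rd) (x : Rd) (i : 'I_d).

Let mOm : measurable (Om : set Ld) := open_measurableL oOm.

Lemma integrable_ip f g : Lp mu Om 2%:E f -> Lp mu Om 2%:E g ->
  mu.-integrable Om (EFin \o (fun x => f x * g x)).
Proof. exact: integrable_Lp2M. Qed.

Lemma ipDl f g h : Lp mu Om 2%:E f -> Lp mu Om 2%:E g -> Lp mu Om 2%:E h ->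
  ip Om (f \+ g) h = ip Om f h + ip Om g h.
Proof.
move=> fL gL hL; rewrite /ip -RintegralD//; try exact: integrable_ip.
by apply: eq_Rintegral => x _; rewrite -mulrDl.
Qed.

Lemma ipBl f g h : Lp mu Om 2%:E f -> Lp mu Om 2%:E g -> Lp mu Om 2%:E h ->
  ip Om (f \- g) h = ip Om f h - ip Om g h.
Proof.
move=> fL gL hL; rewrite /ip -RintegralB//; try exact: integrable_ip.
by apply: eq_Rintegral => x _; rewrite -mulrBl.
Qed.

Lemma ipC f g : ip Om f g = ip Om g f.
Proof. by apply: eq_Rintegral => x _; rewrite mulrC. Qed.

(** Dominated convergence along the test functions [phi \* cutoff Om m]: cutoffs lie in [0, 1], so
    |r phi| dominates, and it is integrable as a product of two L^2 functions. *)
Lemma ip_smooth_eq0 r phi : Lp mu Om 2%:E r ->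
  (forall psi, test_function Om psi -> ip Om r psi = 0) ->
  Cinfty phi -> Lp mu Om 2%:E phi -> ip Om r phi = 0.
Proof.
move=> rL r0 Cphi phiL; have mr := measurable_Lp mOm rL.
have cphi := Cinfty_continuous Cphi.
have tcut m : test_function Om (phi \* cutoff Om m).
  by apply: test_functionMl => //; exact: test_function_cutoff.
have mprod g : continuous g ->
    measurable_fun (Om : set Ld) (EFin \o (fun x : Ld => r x * g x)).
  move=> cg; apply/measurable_EFinP; apply: measurable_funM => //.
  exact: measurable_continuousL.
have int0 m : (\int[mu]_(x in Om) (r x * (phi \* cutoff Om m) x)%:E = 0)%E.
  have fin := integrable_fin_num mOm (integrable_ip rL (test_function_Lp2 mOm (tcut m))).
  by rewrite -[LHS](fineK fin); congr EFin; exact: r0.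
have [] := @dominated_convergence _ _ R mu Om mOm
  (fun m x => (r x * (phi \* cutoff Om m) x)%:E) (EFin \o (fun x => r x * phi x))
  (abse \o (EFin \o (fun x => r x * phi x))).
- move=> m; apply: mprod; case: (tcut m) => + _ _; exact: Cinfty_continuous.
- exact: mprod.
- apply: aeW => x Omx; apply/cvg_EFin; first exact: nearW.
  rewrite -[r x * phi x]mulr1; under eq_fun do rewrite /= mulrA.
  by apply: cvgM; [exact: cvg_cst|exact: cvg_cutoff].
- exact: integrable_abse (integrable_ip rL phiL).
- apply: aeW => x m _ /=; rewrite lee_fin mulrA normrM ler_piMr//.
  by have /andP[c0 c1] := cutoff_itv Om m x; rewrite ger0_norm.
move=> _ _; rewrite (_ : [sequence _]_n = cst 0%E); last first.
  by apply/funext => m; exact: int0.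
move=> /(cvg_unique (@ereal_hausdorff R) (cvg_cst _)) e.
by rewrite /ip /Rintegral -[X in fine X]e.
Qed.

(* The smooth approximants of l supplied by [has_trace] spare the fundamental
   lemma of the calculus of variations. *)
Lemma ip_H1_eq0 r (l : H1 Om) : Lp mu Om 2%:E r ->
  (forall psi, test_function Om psi -> ip Om r psi = 0) -> ip Om r l = 0.
Proof.
move=> rL r0; have [phi [Cphi [phiL cphi] _ _]] := traceP l.
have lL := H1_L2 l.
have ip_le k : (`|ip Om r l|%:E <=
    Lnorm mu 2%:E (EFin \o (r \_ Om)) *
    Lnorm mu 2%:E (EFin \o ((phi k \- l)%R \_ Om)))%E.
  have phikL : Lp mu Om 2%:E (phi k).
    rewrite (_ : phi k = (phi k \- l) \+ l); first exact: LpD (le1_2e R) (phiL k) lL.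
    by apply/funext => x /=; rewrite subrK.
  have -> : `|ip Om r l| = `|ip Om r (phi k \- l)|.
    rewrite [in RHS]ipC ipBl// [ip Om (phi k) r]ipC [ip Om l r]ipC.
    by rewrite (ip_smooth_eq0 rL r0 (Cphi k) phikL) sub0r normrN.
  exact: (hoelder_Lp2 mOm rL (phiL k)).
(* Finiteness of this factor lets the product of norms inherit the limit 0 of the other one. *)
have finr : Lnorm mu 2%:E (EFin \o (r \_ Om)) \is a fin_num.
  move: rL; rewrite /Lp inE => /andP[_]; rewrite inE/= /finite_norm => rL.
  by rewrite ge0_fin_numE// Lnorm_ge0.
have := cvgeZl finr cphi; rewrite mule0 => cv.
suff : (`|ip Om r l|%:E <= 0)%E by rewrite lee_fin normr_le0 => /eqP.
rewrite -(cvg_lim (@ereal_hausdorff R) cv); apply: lime_ge; first exact: cvgP cv.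
by apply: nearW => k; exact: ip_le.
Qed.

(** [q] and [q'] have the same pairing with every test function, namely the one prescribed by [F],
    so their difference annihilates all test functions. *)
Lemma weak_divergence_unique F q q' (l : H1 Om) :
  Lp mu Om 2%:E q -> Lp mu Om 2%:E q' ->
  weak_divergence Om F q -> weak_divergence Om F q' -> ip Om q l = ip Om q' l.
Proof.
move=> qL q'L dq dq'; apply/eqP; rewrite -subr_eq0 -ipBl//; last exact: H1_L2.
apply/eqP/ip_H1_eq0; first exact: LpB (le1_2e R) qL q'L.
move=> psi tpsi; rewrite ipBl//; last exact: test_function_Lp2.
by apply/eqP; rewrite subr_eq0 -eqr_opp -dq// -dq'.
Qed.

Lemma dotvDl (x y w : Rd) : dotv (x + y) w = dotv x w + dotv y w.
Proof. by rewrite /dotv -big_split; apply: eq_bigr => i _; rewrite mxE mulrDl. Qed.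

Lemma dotvNl (x w : Rd) : dotv (- x) w = - dotv x w.
Proof. by rewrite /dotv -sumrN; apply: eq_bigr => i _; rewrite mxE mulNr. Qed.

Lemma dotvZl (a : R) (x w : Rd) : dotv (a *: x) w = a * dotv x w.
Proof. by rewrite /dotv mulr_sumr; apply: eq_bigr => i _; rewrite mxE mulrA. Qed.

(** The two sides are the entries of 1 x 1 matrices that are transposes of each other. *)
Lemma dotv_sym_mx (A : 'M[R]_d) (x y : Rd) : A^T = A ->
  dotv (x *m A) y = dotv (y *m A) x.
Proof.
have dotvE (v w : Rd) : dotv v w = (v *m w^T) 0 0.
  by rewrite mxE; apply: eq_bigr => i _; rewrite mxE.
move=> AT; rewrite !dotvE.
have <- : (x *m A *m y^T)^T = y *m A *m x^T by rewrite !trmx_mul trmxK AT mulmxA.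
by rewrite [RHS]mxE.
Qed.

Lemma integrable_ipv F G : L2v Om F -> L2v Om G ->
  mu.-integrable Om (EFin \o (fun x => dotv (F x) (G x))).
Proof.
move=> FL GL; rewrite (_ : _ \o _ = (fun x => \sum_i (F x 0 i * G x 0 i)%:E)%E).
  by apply: integrable_sum => // i _; exact: integrable_ip.
by apply/funext => x /=; rewrite /dotv sumEFin.
Qed.

Lemma ipvDl F G (H : Rd -> Rd) : L2v Om F -> L2v Om G -> L2v Om H ->
  ipv Om (fun x => F x + G x) H = ipv Om F H + ipv Om G H.
Proof.
move=> FL GL HL; rewrite /ipv -RintegralD//; try exact: integrable_ipv.
by apply: eq_Rintegral => x _; rewrite dotvDl.
Qed.

Lemma ipvNl F (H : Rd -> Rd) : L2v Om F -> L2v Om H ->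
  ipv Om (fun x => - F x) H = - ipv Om F H.
Proof.
move=> FL HL; rewrite /ipv -mulN1r -RintegralZl//; last exact: integrable_ipv.
by apply: eq_Rintegral => x _; rewrite dotvNl mulN1r.
Qed.

Lemma L2vD F G : L2v Om F -> L2v Om G -> L2v Om (fun x => F x + G x).
Proof.
move=> FL GL i; rewrite (_ : (fun x => _) = (fun x => F x 0 i) \+ (fun x => G x 0 i)).
  exact: LpD (le1_2e R) (FL i) (GL i).
by apply/funext => x; rewrite mxE.
Qed.

Lemma L2vN F : L2v Om F -> L2v Om (fun x => - F x).
Proof.
move=> FL i; rewrite (_ : (fun x => _) = \- (fun x => F x 0 i)).
  exact: LpN (FL i).
by apply/funext => x; rewrite mxE.
Qed.

End weak_divergence.

(** * Fluxes of the primal and adjoint problems *)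

Section problem_theory.
Context (R : realType) (d : nat).
Variable P : problem R d.
Local Notation Rd := 'rV[R]_d.
Local Notation Ld := (caratheodory_type (@lebesgue_outer R d)).
Local Notation mu := (leb R d).
Local Notation Om := (Omega P).
Local Notation L2 f := (Lp mu Om 2%:E f).
Implicit Types (f g q : Rd -> R) (F G : Rd -> Rd) (u z l : H1 Om).
Variables a0 a1 : R.
Hypothesis oOm : open Om.
Hypothesis coefficientsP : coefficients_ok P a0 a1.
Hypothesis dataP : data_ok P.

Let mOm : measurable (Om : set Ld) := open_measurableL oOm.

Lemma L2v_Amul F : L2v Om F -> L2v Om (Amul P F).
Proof.
move=> FL i; have [AL _ _ _] := coefficientsP.
rewrite (_ : (fun x => _) = fun x => \sum_j coefA P x i j * F x 0 j).
  by apply: Lp_sum => [|j]; [exact: le1_2e|exact: LpooM2].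
by apply/funext => x; rewrite mxE; apply: eq_bigr => j _; rewrite mxE mulrC.
Qed.

Lemma L2_convection F : L2v Om F -> L2 (fun x => dotv (coefb P x) (F x)).
Proof.
move=> FL; have [_ _ bL _] := coefficientsP.
by apply: Lp_sum => [|j]; [exact: le1_2e|exact: LpooM2].
Qed.

Lemma L2_reaction f : L2 f -> L2 (fun x => coefc P x * f x).
Proof. by move=> fL; have [_ _ _ cL] := coefficientsP; exact: LpooM2. Qed.

Lemma L2v_drift f : L2 f -> L2v Om (fun x => f x *: coefb P x).
Proof.
move=> fL i; have [_ _ bL _] := coefficientsP.
rewrite (_ : (fun x => _) = fun x => coefb P x 0 i * f x); first exact: LpooM2.
by apply/funext => x; rewrite mxE mulrC.
Qed.

Lemma ipv_Amul_sym F G : L2v Om F -> L2v Om G ->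
  ipv Om (Amul P F) G = ipv Om (Amul P G) F.
Proof.
move=> FL GL; have [_ symA _ _] := coefficientsP.
have mAmul H K : L2v Om H -> L2v Om K ->
    measurable_fun (Om : set Ld) (fun x : Ld => dotv (Amul P H x) (K x)).
  move=> HL KL; apply/measurable_EFinP.
  by have /integrableP[] := integrable_ipv oOm (L2v_Amul HL) KL.
apply: (ae_eq_Rintegral mOm (mAmul _ _ FL GL) (mAmul _ _ GL FL) symA) => x [symAx _].
by apply: dotv_sym_mx; rewrite symAx.
Qed.

(** Collects the form around its first argument: A grad z + b z, the field occurring in [flux_d], is
    now what pairs with the gradient of [u]. *)
Lemma aform_adjointE u z : aform u z =
  ipv Om (Amul P (grad z)) (grad u) + ipv Om (fun x => z x *: coefb P x) (grad u) +
  ip Om (fun x => coefc P x * z x) u.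
Proof.
rewrite /aform ipv_Amul_sym; try exact: grad_L2.
rewrite -addrA; congr (_ + _).
have bL := L2_convection (grad_L2 u); have cL := L2_reaction (H1_L2 u).
rewrite (ipDl oOm bL cL (H1_L2 z)); congr (_ + _); apply: eq_Rintegral => x _.
  by rewrite dotvZl mulrC.
by rewrite mulrAC.
Qed.

(** [get] picks an element of a set known to be inhabited thanks to [q0] and [u0]. The divergence it
    comes with may be exchanged for [q0] by uniqueness; independence of the lifting remains as a
    hypothesis, supplied later by the measurement equations. *)
Lemma flux_pairingE F psi phi q0 u0 (c : R) :
  L2 q0 -> weak_divergence Om F q0 -> trace_eq (GammaD P) phi u0 ->
  (forall l, trace_eq (GammaD P) phi l ->
    ipv Om F (grad l) + ip Om q0 l - bip (GammaN P) psi (trace l) = c) ->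
  flux_pairing P F psi phi = c.
Proof.
move=> q0L dq0 tru0 cE; rewrite /flux_pairing; set S := [set _ | _].
have [q [l [qL dq trl ->]]] : S (get S).
  apply: getPex; exists (ipv Om F (grad u0) + ip Om q0 u0 - bip (GammaN P) psi (trace u0)).
  by exists q0, u0.
by rewrite (weak_divergence_unique oOm l qL q0L dq dq0) cE.
Qed.

Lemma bip_trace0 (Gamma : set Rd) psi : bip Gamma psi (fun=> 0) = 0.
Proof.
rewrite /bip /Rintegral; under eq_integral do rewrite mulr0.
by rewrite integral0.
Qed.

(** * The primal flux sigma and the divergence prescribed by the strong equation *)

Definition div_flux_p u x :=
  dat_f1 P x - (dotv (coefb P x) (grad u x) + coefc P x * u x).

Lemma ipv_flux_p u F : L2v Om F ->
  ipv Om (flux_p u) F = - ipv Om (Amul P (grad u)) F - ipv Om (dat_f2 P) F.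
Proof.
move=> FL; have [_ [f2L _] _ _] := dataP.
have AL := L2v_Amul (grad_L2 u).
by rewrite ipvDl ?ipvNl//; exact: L2vN.
Qed.

Lemma L2_div_flux_p u : L2 (div_flux_p u).
Proof.
have [[f1L _] _ _ _] := dataP; apply: (LpB (le1_2e R) f1L).
apply: (LpD (le1_2e R)); first exact/L2_convection/grad_L2.
exact/L2_reaction/H1_L2.
Qed.

(** Valid for every [u], by linearity alone and without integration by parts: the data terms
    assemble into ell(l), the coefficient terms into -a(u,l). *)
Lemma flux_p_green u l :
  ipv Om (flux_p u) (grad l) + ip Om (div_flux_p u) l
    - bip (GammaN P) (psip P) (trace l) = ellfunctional l - aform u l.
Proof.
have [[f1L _] _ _ _] := dataP.
have bcL : L2 (fun x => dotv (coefb P x) (grad u x) + coefc P x * u x).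
  apply: (LpD (le1_2e R)); first exact/L2_convection/grad_L2.
  exact/L2_reaction/H1_L2.
rewrite ipv_flux_p; last exact: grad_L2.
rewrite (ipBl oOm f1L bcL (H1_L2 l)) /ellfunctional /aform; ring.
Qed.

(** A test function has zero trace, which kills the Neumann term and makes it admissible in the weak
    equation, so the right-hand side of [flux_p_green] vanishes. *)
Lemma weak_divergence_flux_p u : primal_weak u ->
  weak_divergence Om (flux_p u) (div_flux_p u).
Proof.
move=> [_ weak] phi tphi; have [s [sE gE tE]] := test_function_H1 oOm tphi.
have HDs : HD s by apply: aeW => x _; rewrite tE.
have := flux_p_green u s; rewrite weak// subrr tE bip_trace0 subr0 gE sE.
by move=> /eqP; rewrite addr_eq0 => /eqP.
Qed.

(** The measurement equation gives ell(l) - a(u,l) the same value gamma - m(u) at every lifting l;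
    [z] only ensures that a lifting exists. *)
Lemma flux_pairing_p u gamma : primal_weak u -> (exists z, Xd z) ->
  primal_measurement gamma u ->
  flux_pairing P (flux_p u) (psip P) (phid P) = gamma - mfunctional u.
Proof.
move=> uP [z zX] [_ meas].
apply: (flux_pairingE (L2_div_flux_p u) (weak_divergence_flux_p uP) zX) => l lX.
by rewrite flux_p_green (meas l lX); ring.
Qed.

(** * The adjoint flux r and the divergence prescribed by the strong adjoint equation *)

Definition div_flux_d z x := dat_g1 P x - coefc P x * z x.

Lemma ipv_flux_d z F : L2v Om F -> ipv Om (flux_d z) F =
  - (ipv Om (Amul P (grad z)) F + ipv Om (fun x => z x *: coefb P x) F
     + ipv Om (dat_g2 P) F).
Proof.
move=> FL; have [_ [_ g2L] _ _] := dataP.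
have AL := L2v_Amul (grad_L2 z); have bL := L2v_drift (H1_L2 z).
have AbL := L2vD AL bL.
by rewrite ipvNl ?ipvDl//; exact: L2vD.
Qed.

Lemma L2_div_flux_d z : L2 (div_flux_d z).
Proof.
have [[_ g1L] _ _ _] := dataP; apply: (LpB (le1_2e R) g1L).
exact/L2_reaction/H1_L2.
Qed.

(** Here the lifting is the first argument of the form, so the expansion goes through
    [aform_adjointE] and thus uses the symmetry of A. *)
Lemma flux_d_green z l :
  ipv Om (flux_d z) (grad l) + ip Om (div_flux_d z) l
    - bip (GammaN P) (psid P) (trace l) = mfunctional l - aform l z.
Proof.
have [[_ g1L] _ _ _] := dataP.
have cL := L2_reaction (H1_L2 z).
rewrite ipv_flux_d; last exact: grad_L2.
rewrite (ipBl oOm g1L cL (H1_L2 l)) aform_adjointE /mfunctional; ring.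
Qed.

Lemma weak_divergence_flux_d z : adjoint_weak z ->
  weak_divergence Om (flux_d z) (div_flux_d z).
Proof.
move=> [_ weak] phi tphi; have [s [sE gE tE]] := test_function_H1 oOm tphi.
have HDs : HD s by apply: aeW => x _; rewrite tE.
have := flux_d_green z s; rewrite weak// subrr tE bip_trace0 subr0 gE sE.
by move=> /eqP; rewrite addr_eq0 => /eqP.
Qed.

(** The dual measurement equation fixes m(l) - a(l,z) to gamma - ell(z) for all liftings l of the
    primal Dirichlet datum. *)
Lemma flux_pairing_d z gamma : adjoint_weak z -> (exists u, Xp u) ->
  dual_measurement gamma z ->
  flux_pairing P (flux_d z) (psid P) (phip P) = gamma - ellfunctional z.
Proof.
move=> zP [u uX] [_ meas].
apply: (flux_pairingE (L2_div_flux_d z) (weak_divergence_flux_d zP) uX) => l lX.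
by rewrite flux_d_green (meas l lX); ring.
Qed.

End problem_theory.

(** * Assembling the equalities *)

Unset Implicit Arguments.

Theorem theorem3p5 (R : realType) (d : nat) (d_ge2 : (2 <= d)%N)
    (P : problem R d)
    (domainP : bounded_lipschitz_domain (Omega P))
    (partitionP : boundary_partition (Omega P) (GammaD P) (GammaN P))
    (GammaD_gt0 : (0 < surf R d (GammaD P))%E)
    (a0 a1 : R) (a0_gt0 : 0 < a0) (a0_le_a1 : a0 <= a1)
    (coefficientsP : coefficients_ok P a0 a1)
    (dataP : data_ok P)
    (beta : R) (beta_gt0 : 0 < beta) (infsupP : inf_sup P beta)
    (u z : H1 (Omega P))
    (u_weak : primal_weak u) (z_weak : adjoint_weak z)
    (gamma gamma_p gamma_d : R)
    (gammaE : gamma = Jp u)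
    (gamma_pP : primal_measurement gamma_p u)
    (gamma_dP : dual_measurement gamma_d z) :
  [/\ gamma = gamma_p, gamma_p = Jp u, Jp u = Jd z, Jd z = gamma_d
    & gamma = mfunctional u + ellfunctional z - aform u z].
Proof.
have [oOm _ _ _ _] := domainP.
have [uX _] := u_weak; have [zX _] := z_weak.
(* The remaining terms of [Jp] form m(u), which the flux term gamma_p - m(u) completes to gamma_p;
   [Jd] is treated alike with ell(z). *)
have JpE : Jp u = gamma_p.
  have := flux_pairing_p oOm coefficientsP dataP u_weak (ex_intro _ z zX) gamma_pP.
  by rewrite /Jp -/(mfunctional u) => ->; rewrite addrC subrK.
have JdE : Jd z = gamma_d.
  have := flux_pairing_d oOm coefficientsP dataP z_weak (ex_intro _ u uX) gamma_dP.
  by rewrite /Jd -/(ellfunctional z) => ->; rewrite addrC subrK.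
(* As [z] lies in [Xd] and [u] in [Xp], each may be inserted into the measurement equation satisfied
   by the other. *)
have pE : gamma_p = mfunctional u + ellfunctional z - aform u z by exact: gamma_pP.2.
have dE : gamma_d = mfunctional u + ellfunctional z - aform u z by exact: gamma_dP.2.
by split; rewrite ?gammaE ?JpE ?JdE ?pE ?dE.
Qed.
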